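(* There is no ${\sf MAJ}\circ{\sf LTF}\circ{\sf LTF}$ circuit with $o(n^{3/2}/\log^3 n)$ gates, nor one with $o(n^{5/2}/\log^{7/2} n)$ wires, that computes $B_n$.
   Context: An LTF outputs $1$ iff a real-weighted sum of its inputs is at least a real threshold. An ${\sf LTF}\circ{\sf LTF}$ circuit is a layer of LTF gates on the input variables feeding (possibly together with input variables) one output LTF gate. A ${\sf MAJ}\circ{\sf LTF}\circ{\sf LTF}$ circuit computes the majority value of a collection of ${\sf LTF}\circ{\sf LTF}$ circuits; gates and wires (input connections) are counted over the whole circuit. For integers $t,m$, let $A_{m,t}\in\mathbb{F}_2^{m\times t}$ be the paper's explicit polynomial-time computable matrix whose rows form a small-biased set (from the construction of Alon, Goldreich, H\aa stad and Peralta), with the property that for any $x\neq y$ in $\mathbb{F}_2^t$, the vectors $A_{m,t}x$ and $A_{m,t}y$ agree on $m(1/2+O(\epsilon))$ coordinates, where $\epsilon=t/\sqrt{m}$. For $m$ a power of two, define $F:\{0,1\}^{\log_2 m}\times\{0,1\}^n\to\{0,1\}$ by $F(z,x)=$ the bit of $A_{m,n}x$ in position indexed by $z$. For integers $k\mid n$ with $m=2^k$, define the $2n$-bit function $B_{n,k}(x,a)=F(z,x)$ for $x,a\in\{0,1\}^n$, where $z\in\{0,1\}^k$ has $z_i=\sum_{j=(n/k)(i-1)+1}^{(n/k)i} a_j \bmod 2$. Finally $B_n=B_{n,k}$ with $k=16\log_2 n$. *)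

(* Defs.v *)
From HB Require Import structures.
From mathcomp Require Import all_boot all_order all_algebra.
From mathcomp Require Import all_classical all_reals all_analysis.

Set Implicit Arguments.
Unset Strict Implicit.
Unset Printing Implicit Defensive.

Import Order.TTheory GRing.Theory Num.Theory.
Import numFieldNormedType.Exports.

Local Open Scope ring_scope.

(** * Threshold circuits *)

Record ltf (R : realType) (I : finType) := Ltf {
  weight : I -> R;
  threshold : R }.

Definition ltf_eval (R : realType) (I : finType) (g : ltf R I)
    (x : I -> bool) : bool :=
  threshold g <= \sum_(i : I) weight g i * (x i)%:R.

(* An input whose weight is 0 is not connected to the gate. *)
Definition fanin (R : realType) (I : finType) (g : ltf R I) : nat :=
  #|[set i : I | weight g i != 0]|.

(* A MAJ o LTF o LTF circuit on N input bits.  The LTF o LTF circuits whose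
   majority is taken are the output gates [out_gate c], each reading the input
   variables and the pool of bottom gates.  A bottom gate may be shared by
   several of them, and is then counted once; circuits that share no gate are
   the special case where the out gates have disjoint supports in the pool. *)
Record maj_ltf_ltf (R : realType) (N : nat) := MajLtfLtf {
  nbottom : nat;
  nout : nat;
  bottom_gate : 'I_nbottom -> ltf R 'I_N;
  out_gate : 'I_nout -> ltf R ('I_N + 'I_nbottom)%type }.

Section Circuit.
Variables (R : realType) (N : nat) (C : maj_ltf_ltf R N).

Definition out_input (u : N.-tuple bool) (i : 'I_N + 'I_(nbottom C)) : bool :=
  match i with
  | inl v => tnth u v
  | inr b => ltf_eval (bottom_gate b) (tnth u)
  end.

Definition out_value (u : N.-tuple bool) (c : 'I_(nout C)) : bool :=
  ltf_eval (out_gate c) (out_input u).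

(* Majority is 1 iff at least half of its inputs are 1. *)
Definition circuit_eval (u : N.-tuple bool) : bool :=
  (nout C <= 2 * \sum_(c < nout C) out_value u c)%N.

Definition computes (B : N.-tuple bool -> bool) : Prop :=
  forall u, circuit_eval u = B u.

(* The last summands of [gates] and [wires] are the majority gate and its
   input wires. *)
Definition gates : nat := (nbottom C + nout C + 1)%N.

Definition wires : nat :=
  (\sum_(b < nbottom C) fanin (bottom_gate b)
   + \sum_(c < nout C) fanin (out_gate c) + nout C)%N.

End Circuit.

(** * The hard function *)

(* F_2[X] / (f h) represents GF(2^h); [f] fixes the representations. *)
Definition GF2_moduli (f : nat -> {poly 'F_2}) : Prop :=
  forall h : nat, (0 < h)%N -> irreducible_poly (f h) /\ size (f h) = h.+1.

(* The "powering" construction of Alon, Goldreich, Hastad and Peralta, with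
   m = #|{: k.-tuple bool}| = 2^k rows.  Put h = k/2.  The row of z is given by
   the elements u, v of GF(2^h) with coordinates z_0 ... z_{h-1} and
   z_h ... z_{2h-1}; its i-th entry is the inner product over F_2 of the
   coordinates of u^i and of v.  Two distinct vectors differ by a polynomial of
   degree < t in u, which has fewer than t roots, so that their images agree on
   m (1/2 + O(t / 2^h)) coordinates.  If k is odd, the last bit of z is unused
   and every row is repeated twice, with the same estimate. *)
Definition lo_elt (h k : nat) (z : k.-tuple bool) : {poly 'F_2} :=
  \poly_(j < h) (nth false z j)%:R.

Definition hi_elt (h k : nat) (z : k.-tuple bool) : {poly 'F_2} :=
  \poly_(j < h) (nth false z (h + j)%N)%:R.

Definition aghp_mx (f : nat -> {poly 'F_2}) (k t : nat) :
    'M['F_2]_(#|{: k.-tuple bool}|, t) :=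
  \matrix_(r, i)
    let h := k./2 in
    let z := enum_val r in
    \sum_(j < h) (lo_elt h z ^+ i %% f h)`_j * (hi_elt h z)`_j.

Definition F_fun (f : nat -> {poly 'F_2}) (k n : nat) (z : k.-tuple bool)
    (x : n.-tuple bool) : bool :=
  (aghp_mx f k n *m \col_(i < n) (tnth x i)%:R) (enum_rank z) ord0 == 1.

(* Parities of the k consecutive blocks of n/k bits of a (for k dividing n). *)
Definition block_parities (k n : nat) (a : n.-tuple bool) : k.-tuple bool :=
  [tuple odd (\sum_(j < n | n %/ k * i <= j < n %/ k * i.+1) tnth a j)%N
   | i < k].

Definition B_fun (f : nat -> {poly 'F_2}) (n k : nat)
    (w : (n + n).-tuple bool) : bool :=
  let x := [tuple tnth w (lshift n i) | i < n] in
  let a := [tuple tnth w (rshift n i) | i < n] in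
  F_fun f (block_parities k a) x.

(* k = 16 log_2 n, rounded down if n is not a power of two; B_n is considered
   only for the n that this k divides. *)
Definition kparam (n : nat) : nat := (16 * trunc_log 2 n)%N.

(* Main.v *)
Require Import Defs.
From mathcomp Require Import all_boot all_order all_algebra all_field.
From mathcomp Require Import all_classical all_reals all_analysis.
From mathcomp Require Import ring lra zify.

(* Fix x.  Restrict a by choosing one free bit in each of its k blocks and
   fixing the other bits: the free bits then prescribe z, so the restricted
   circuit computes the code word z |-> F(z,x).  Averaging over the
   restrictions, all bottom gates but few depend on at most one free bit.  The
   others number o(n / k^2), so each LTF o LTF circuit below the majority
   becomes one of 2^o(n) functions of z.  By the discriminator argument one of
   these functions has correlation 1 / poly(n) with the code word of x; by the
   small bias of the code, each of them has such a correlation with only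
   poly(n) code words, while there are 2^n values of x.

   The bound on the surviving gates needs no Littlewood-Offord inequality.  If
   v and v' set the free bits to the values that minimize and maximize the
   gate G, then [G is not constant] = G(v') - G(v).  The laws of v and v' have
   densities prod_i (1 -+ e_i) with respect to the uniform law, where e_i is a
   sign depending on the free bit of block i, so the probability of survival
   is at most the L2 distance of the averages of these densities over the
   choice of the free bits. *)

Set Implicit Arguments.
Unset Strict Implicit.
Unset Printing Implicit Defensive.

Import Order.TTheory GRing.Theory Num.Theory.
Import numFieldNormedType.Exports.

Local Open Scope ring_scope.

(** * Random restrictions *)

Lemma sum_prod_pair (R : comNzRingType) (K Q Q' : finType)
    (F : K -> Q -> Q' -> R) :
  \sum_(r : {ffun K -> Q}) \sum_(r' : {ffun K -> Q'}) \prod_i F i (r i) (r' i) =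
  \prod_i \sum_t \sum_t' F i t t'.
Proof.
rewrite bigA_distr_bigA /=; apply: eq_bigr => r _.
by rewrite bigA_distr_bigA.
Qed.

Section Restriction.
Variables (R : realFieldType) (K Q : finType).
Local Notation asg := {ffun K -> {ffun Q -> bool}}.

(* [r i] is the free bit of block [i], and receives the value [y i]. *)
Definition plug (r : {ffun K -> Q}) (y : {ffun K -> bool}) (a : asg) : asg :=
  [ffun i => [ffun t => if t == r i then y i else a i t]].

(* Exchanging [y] with the bits of [a] at [r] is an involution. *)
Lemma sum_plug (r : {ffun K -> Q}) (F : asg -> R) :
  \sum_y \sum_a F (plug r y a) = 2 ^+ #|K| * \sum_a F a.
Proof.
rewrite exchange_big pair_big /=.
pose swap (p : asg * {ffun K -> bool}) := (plug r p.2 p.1, [ffun i =>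
  p.1 i (r i)]).
have swapK : involutive swap.
  move=> [a y]; rewrite /swap /=; congr pair.
    apply/ffunP => i; apply/ffunP => t; rewrite !ffunE.
    by case: eqP => [->|].
  by apply/ffunP => i; rewrite !ffunE eqxx.
rewrite (reindex_inj (inv_inj swapK)) /=.
under eq_bigr => p _.
  have -> : plug r [ffun i => p.1 i (r i)] (plug r p.2 p.1) = p.1.
    by have := congr1 fst (swapK p).
  over.
rewrite -(pair_big xpredT xpredT (fun a _ => F a)) /=.
rewrite mulr_sumr; apply: eq_bigr => a _.
by rewrite sumr_const card_ffun card_bool -natrX mulr_natl.
Qed.

Definition lin (b : K -> Q -> R) (a : asg) : R :=
  \sum_i \sum_t b i t * (a i t)%:R.

Definition fires (b : K -> Q -> R) (th : R) (a : asg) : bool := th <= lin b a.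

Definition hits (b : K -> Q -> R) (r : {ffun K -> Q}) : {set K} :=
  [set i | b i (r i) != 0].

(* [false] maximizes the weighted sum, [true] minimizes it. *)
Definition extremal (s : bool) (b : K -> Q -> R) (r : {ffun K -> Q}) :
  {ffun K -> bool} := [ffun i => 0 < (-1) ^+ s * b i (r i)].

(* A gate that is not bad is absorbed by the output gates: if at most one free
   bit is hit, the gate is an affine function of that bit. *)
Definition bad (b : K -> Q -> R) (th : R) (r : {ffun K -> Q}) (a : asg) :=
  [&& (1 < #|hits b r|)%N, fires b th (plug r (extremal false b r) a)
    & ~~ fires b th (plug r (extremal true b r) a)].

Definition rest (b : K -> Q -> R) (r : {ffun K -> Q}) (a : asg) : R :=
  \sum_i \sum_(t | t != r i) b i t * (a i t)%:R.

Lemma lin_plug b r y a :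
  lin b (plug r y a) = rest b r a + \sum_i b i (r i) * (y i)%:R.
Proof.
rewrite /lin /rest -big_split /=; apply: eq_bigr => i _.
rewrite (bigD1 (r i)) //= !ffunE eqxx addrC; congr (_ + _).
by apply: eq_bigr => t /negbTE ne; rewrite !ffunE ne.
Qed.

Lemma lin_plug_top b r y a : lin b (plug r y a) <= lin b (plug r (extremal
  false b r) a).
Proof.
rewrite !lin_plug lerD2l; apply: ler_sum => i _; rewrite ffunE.
rewrite /= ?expr0 ?expr1 ?mul1r ?mulN1r ?oppr_gt0.
by case: (y i); case: ltrP => /= bi; rewrite ?mulr0 ?mulr1 //; exact: ltW.
Qed.

Lemma lin_plug_bot b r y a : lin b (plug r (extremal true b r) a) <= lin b
  (plug r y a).
Proof.
rewrite !lin_plug lerD2l; apply: ler_sum => i _; rewrite ffunE.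
rewrite /= ?expr0 ?expr1 ?mul1r ?mulN1r ?oppr_gt0.
by case: (y i); case: ltrP => /= bi; rewrite ?mulr0 ?mulr1 //; exact: ltW.
Qed.

(** An output gate can absorb an affine function of the free bits into its own weights and
    threshold. If the minimal setting fires, the gate is constantly 1; if the maximal one does not,
    it is constantly 0; otherwise at most one free bit is hit, and every function of one bit is
    affine. *)
Lemma not_bad_affine b th r a : ~~ bad b th r a ->
  exists (c0 : R) (c : K -> R), forall y,
    (fires b th (plug r y a))%:R = c0 + \sum_i c i * (y i)%:R.
Proof.
have const v : (forall y, fires b th (plug r y a) = v) ->
  exists (c0 : R) (c : K -> R), forall y,
    (fires b th (plug r y a))%:R = c0 + \sum_i c i * (y i)%:R.
  move=> fv; exists v%:R, (fun=> 0) => y; rewrite fv big1 ?addr0 // => i _.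
  by rewrite mul0r.
rewrite /bad.
case: (boolP (fires b th (plug r (extremal true b r) a))) => [fb _|nfb].
  apply: (const true) => y; exact: le_trans fb (lin_plug_bot _ _ _ _).
case: (boolP (fires b th (plug r (extremal false b r) a))) => [_|nft _];
  last first.
  apply: (const false) => y; apply: contraNF nft => fy.
  exact: le_trans fy (lin_plug_top _ _ _ _).
rewrite !andbT -leqNgt leq_eqVlt => /orP[/cards1P[i Hi]|].
  have sumE y : \sum_j b j (r j) * (y j : bool)%:R = b i (r i) * (y i)%:R.
    rewrite (bigD1 i) //= big1 ?addr0 // => j ji.
    have : j \notin hits b r by rewrite Hi inE.
    by rewrite inE negbK => /eqP ->; rewrite mul0r.
  pose f (v : bool) : R := (th <= rest b r a + b i (r i) * v%:R)%R%:R.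
  exists (f false), (fun j => if j == i then f true - f false else 0) => y.
  rewrite (bigD1 i) //= big1 ?addr0 => [|j /negbTE ->]; last by rewrite mul0r.
  rewrite eqxx /fires lin_plug sumE.
  by rewrite /f; case: (y i); rewrite /= ?mulr1 ?mulr0 ?addr0 // addrCA subrr
    addr0.
rewrite ltnS leqn0 cards_eq0 => /eqP Hi.
apply: (const (th <= rest b r a)) => y;
  rewrite /fires lin_plug big1 ?addr0 // => j _.
have : j \notin hits b r by rewrite Hi inE.
by rewrite inE negbK => /eqP ->; rewrite mul0r.
Qed.

(** Lagrange's identity: the sum of the squares of [f x * g y - f y * g x] over all pairs is twice
    the difference of the two sides. *)
Lemma cauchy_schwarz (T : finType) (f g : T -> R) :
  (\sum_x f x * g x) ^+ 2 <= (\sum_x f x ^+ 2) * (\sum_x g x ^+ 2).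
Proof.
have : 0 <= \sum_x \sum_y (f x * g y - f y * g x) ^+ 2.
  by apply: sumr_ge0 => x _; apply: sumr_ge0 => y _; exact: sqr_ge0.
under eq_bigr => x _.
  under eq_bigr => y _.
    have -> : (f x * g y - f y * g x) ^+ 2 = f x ^+ 2 * g y ^+ 2
      + (g x ^+ 2 * f y ^+ 2 - 2 * (f x * g x) * (f y * g y)) by ring.
    over.
  rewrite big_split sumrB /= -!mulr_sumr.
  over.
rewrite big_split sumrB /= -!mulr_suml -mulr_sumr; lra.
Qed.

(** The sign [e_i] of the densities: 1 or -1 as the free bit maximizes or minimizes the sum, and 0
    if its weight vanishes, so that [1 + edge] is 2, 0 or 1. *)
Definition edge (b : K -> Q -> R) (r : {ffun K -> Q}) (a : asg) (i : K) : R :=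
  Num.sg (b i (r i)) * (-1) ^+ (~~ a i (r i)).

(** A change of measure: moving the free bits to their extremal values amounts to reweighting the
    uniform law by a product density. *)
Lemma sum_extremal s b th r :
  \sum_a (fires b th (plug r (extremal s b r) a))%:R =
  \sum_a (fires b th a)%:R * \prod_i (1 + (-1) ^+ s * edge b r a i).
Proof.
have two0 : (2 : R) ^+ #|K| != 0 by rewrite expf_neq0 // pnatr_eq0.
apply: (mulfI two0); rewrite -[RHS](sum_plug r) [RHS]exchange_big mulr_sumr /=.
apply: eq_bigr => a _.
pose w (v : bool) i : R := 1 + (-1) ^+ s * (Num.sg (b i (r i)) * (-1) ^+ ~~ v).
(* In each block the two values of [w] add up to 2, which yields the factor [2 ^+ #|K|]. *)
transitivity (\sum_(y : {ffun K -> bool})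
    (fires b th (plug r (extremal s b r) a))%:R * \prod_i w (y i) i).
  rewrite -mulr_sumr mulrC; congr (_ * _).
  rewrite -(bigA_distr_bigA (fun i v => w v i)) /=.
  rewrite (eq_bigr (fun=> 2)) ?prodr_const // => i _.
  by rewrite big_bool /w /= expr0 expr1; ring.
apply: eq_bigr => y _.
have -> : \prod_i (1 + (-1) ^+ s * edge b r (plug r y a) i) = \prod_i w (y i) i.
  by apply: eq_bigr => i _; rewrite /edge !ffunE eqxx.
(* The density vanishes unless [y] is extremal on every hit block; on the other blocks the free bit
   has weight 0, so its value does not affect the sum. *)
case: (eqVneq (\prod_i w (y i) i) 0) => [->|/prodf_neq0 nz];
  first by rewrite !mulr0.
congr (_%:R * _); rewrite /fires !lin_plug.
congr (nat_of_bool (_ <= _ + _)%R); apply: eq_bigr => i _; rewrite ffunE.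
move: (nz i isT); rewrite /w; case: sgrP => [->|bi|bi].
- by rewrite !mul0r.
- by case: s {w nz}; case: (y i);
  rewrite /= ?expr0 ?expr1 ?mulN1r ?mul1r ?oppr_gt0 ?bi ?(lt_gtF bi) // ?subrr
    ?mulr1 ?mulrN1 ?subrr ?eqxx.
- by case: s {w nz}; case: (y i);
  rewrite /= ?expr0 ?expr1 ?mulN1r ?mul1r ?oppr_gt0 ?bi ?(lt_gtF bi) // ?opprK
    ?mulr1 ?mulrN1 ?subrr ?addNr ?opprK ?subrr ?eqxx.
Qed.

Definition coll (b : K -> Q -> R) (i : K) (t t' : Q) : R :=
  ((t == t') && (b i t != 0))%:R.

(** For uniform bits each sign averages to 0, and the product of the two signs averages to 1 if
    [t = t'] and to 0 otherwise. *)
Lemma sum_block (x x' : R) (t t' : Q) :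
  \sum_(c : {ffun Q -> bool})
     (1 + x * (-1) ^+ (~~ c t)) * (1 + x' * (-1) ^+ (~~ c t')) =
  2 ^+ #|Q| * (1 + (t == t')%:R * (x * x')).
Proof.
pose f u (v : bool) : R := (if u == t then 1 + x * (-1) ^+ ~~ v else 1)
   * (if u == t' then 1 + x' * (-1) ^+ ~~ v else 1).
rewrite (eq_bigr (fun c : {ffun Q -> bool} => \prod_u f u (c u))); last first.
  by move=> c _; rewrite big_split /= -!big_mkcond !big_pred1_eq.
rewrite -(bigA_distr_bigA f) /=.
rewrite (eq_bigr (fun u => 2 * if u == t then 1 + (t == t')%:R * (x * x') else
  1)).
  by rewrite big_split /= prodr_const -big_mkcond big_pred1_eq.
move=> u _; rewrite big_bool /f /= expr0 expr1.
by case: (eqVneq u t) => [->|_]; case: eqVneq => _ /=; ring.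
Qed.

Lemma sum_edges (s s' : bool) b r r' :
  \sum_a \prod_i (1 + (-1) ^+ s * edge b r a i)
         * \prod_i (1 + (-1) ^+ s' * edge b r' a i) =
  #|asg|%:R * \prod_i (1 + (-1) ^+ (s (+) s') * coll b i (r i) (r' i)).
Proof.
pose f i (c : {ffun Q -> bool}) : R :=
  (1 + (-1) ^+ s * Num.sg (b i (r i)) * (-1) ^+ (~~ c (r i)))
  * (1 + (-1) ^+ s' * Num.sg (b i (r' i)) * (-1) ^+ (~~ c (r' i))).
rewrite (eq_bigr (fun a : asg => \prod_i f i (a i))); last first.
  by move=> a _; rewrite -big_split; apply: eq_bigr => i _;
    rewrite /f /edge !mulrA.
rewrite -(bigA_distr_bigA f) /=.
rewrite (eq_bigr (fun i => 2 ^+ #|Q| * (1 + (-1) ^+ (s (+) s') * coll b i (r i)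
  (r' i)))).
  by rewrite big_split /= prodr_const !card_ffun card_bool !natrX.
move=> i _; rewrite /f sum_block /coll; congr (_ * (_ + _)).
rewrite mulrACA -signr_addb.
case: eqVneq => [<-|_] /=; last by rewrite !(mul0r, mulr0).
by rewrite mul1r -expr2 sqr_sg.
Qed.

(** Without a collision both products are 1. With a collision at [i], dropping the second product
    leaves twice the product over [j != i], which is a term of the sum. *)
Lemma prod_coll_sub b (r r' : {ffun K -> Q}) :
  \prod_i (1 + coll b i (r i) (r' i)) - \prod_i (1 - coll b i (r i) (r' i)) <=
  2 * \sum_i coll b i (r i) (r' i) * \prod_(j | j != i) (1 + coll b j (r j) (r'
    j)).
Proof.
have c0 i : 0 <= coll b i (r i) (r' i) by exact: ler0n.
have c1 i : coll b i (r i) (r' i) <= 1 by rewrite /coll; case: (_ && _).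
have p0 i : 0 <= \prod_(j | j != i) (1 + coll b j (r j) (r' j)).
  by apply: prodr_ge0 => j _; exact: addr_ge0.
case: (pickP (fun i => coll b i (r i) (r' i) != 0)) => [i ci|call].
  have {}ci : coll b i (r i) (r' i) = 1.
    by move: ci; rewrite /coll; case: (_ && _); rewrite //= eqxx.
  apply: (@le_trans _ _ (\prod_j (1 + coll b j (r j) (r' j)))).
    by rewrite gerBl; apply: prodr_ge0 => j _; rewrite subr_ge0.
  rewrite (bigD1 i) //= ci; apply: ler_wpM2l; first exact: addr_ge0.
  rewrite [leRHS](bigD1 i) //= ci mul1r lerDl; apply: sumr_ge0 => j _.
  exact: mulr_ge0.
have {}call i : coll b i (r i) (r' i) = 0 by move/negbFE/eqP: (call i).
rewrite !big1 => [|i _|i _|i _];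
  rewrite ?call ?subrr ?mulr0 ?mul0r ?subr0 ?addr0 //.
Qed.

(* The second moment of the difference of the densities, with two independent
   copies r and r' of the positions of the free bits; only the collisions
   r i = r' i contribute. *)
Definition coll_mass (b : K -> Q -> R) : R :=
  \sum_(r : {ffun K -> Q}) \sum_(r' : {ffun K -> Q}) (1 < #|hits b r|)%:R *
  \sum_i coll b i (r i) (r' i) * \prod_(j | j != i) (1 + coll b j (r j) (r' j)).

(** In the constant 4, one factor 2 comes from the four cross terms of the two densities, which
    agree in pairs, and the other from [prod_coll_sub]. *)
Lemma bad_mass b th :
  (\sum_r \sum_a (bad b th r a)%:R) ^+ 2 <= 4 * #|asg|%:R ^+ 2 * coll_mass b.
Proof.
pose W r : R := (1 < #|hits b r|)%:R.
pose P s r a : R := \prod_i (1 + (-1) ^+ (s : bool) * edge b r a i).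
pose Z a := \sum_r W r * (P false r a - P true r a).
have -> : \sum_r \sum_a (bad b th r a)%:R = \sum_a (fires b th a)%:R * Z a.
  rewrite /Z; under [RHS]eq_bigr => a _ do rewrite mulr_sumr.
  rewrite [RHS]exchange_big /=; apply: eq_bigr => r _.
  (* A gate that fires at the minimum fires at the maximum, so the difference of the two indicators
     is the indicator of not being constant. *)
  transitivity (W r * (\sum_a (fires b th (plug r (extremal false b r) a))%:R
      - \sum_a (fires b th (plug r (extremal true b r) a))%:R)).
    rewrite -sumrB mulr_sumr; apply: eq_bigr => a _.
    rewrite /bad /W; case: (1 < #|hits b r|)%N => /=; last by rewrite mul0r.
    rewrite mul1r.
    case fb: (fires _ _ (plug r (extremal true b r) a));
      last by rewrite andbT subr0.
    by rewrite /fires (le_trans fb (lin_plug_top _ _ _ _)) subrr.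
  rewrite !sum_extremal -sumrB mulr_sumr; apply: eq_bigr => a _.
  by rewrite -mulrBr mulrCA.
apply: le_trans (cauchy_schwarz _ _) _.
have fires_le : \sum_a (fires b th a)%:R ^+ 2 <= #|asg|%:R :> R.
  rewrite -sum1_card natr_sum; apply: ler_sum => a _.
  by case: (fires b th a); rewrite /= ?expr1n ?expr0n.
have Z0 : 0 <= \sum_a Z a ^+ 2 by apply: sumr_ge0 => a _; exact: sqr_ge0.
apply: le_trans (ler_wpM2r Z0 fires_le) _.
rewrite (_ : 4 * _ * _ = #|asg|%:R * (#|asg|%:R * (4 * coll_mass b)));
  last by ring.
apply: ler_wpM2l => //.
have -> : \sum_a Z a ^+ 2 = \sum_r \sum_r' W r * W r' *
    \sum_a (P false r a - P true r a) * (P false r' a - P true r' a).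
  rewrite /Z; under eq_bigr => a _.
    rewrite expr2 big_distrl /=; under eq_bigr => r _ do rewrite mulr_sumr.
    over.
  rewrite exchange_big /=; apply: eq_bigr => r _.
  rewrite exchange_big /=; apply: eq_bigr => r' _.
  by rewrite mulr_sumr; apply: eq_bigr => a _; ring.
rewrite /coll_mass mulrA mulr_sumr; apply: ler_sum => r _.
rewrite mulr_sumr; apply: ler_sum => r' _.
have -> : \sum_a (P false r a - P true r a) * (P false r' a - P true r' a) =
   2 * #|asg|%:R * (\prod_i (1 + coll b i (r i) (r' i)) - \prod_i (1 - coll b i
     (r i) (r' i))).
  transitivity (\sum_a P false r a * P false r' a - \sum_a P false r a * P true
    r' a
    - \sum_a P true r a * P false r' a + \sum_a P true r a * P true r' a).
    by rewrite -!sumrB -big_split /=; apply: eq_bigr => a _; ring.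
  rewrite /P !sum_edges /= expr0 expr1.
  have -> : \prod_i (1 + 1 * coll b i (r i) (r' i)) = \prod_i (1 + coll b i (r
    i) (r' i)).
    by apply: eq_bigr => i _; rewrite mul1r.
  have -> : \prod_i (1 + -1 * coll b i (r i) (r' i)) = \prod_i (1 - coll b i (r
    i) (r' i)).
    by apply: eq_bigr => i _; rewrite mulN1r.
  ring.
set X := _ - _; set Y := \sum_i _.
have XY : X <= 2 * Y by exact: prod_coll_sub.
have Y0 : 0 <= Y.
  apply: sumr_ge0 => i _; apply: mulr_ge0; first exact: ler0n.
  by apply: prodr_ge0 => j _; rewrite addr_ge0 // ler0n.
rewrite (_ : _ * (2 * _ * X) = (W r * W r' * (2 * #|asg|%:R)) * X);
  last by ring.
rewrite (_ : #|asg|%:R * 4 * _ = (W r * (2 * #|asg|%:R)) * (2 * Y));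
  last by rewrite /W; ring.
have A0 : 0 <= 2 * #|asg|%:R :> R by rewrite mulr_ge0.
apply: (@le_trans _ _ (W r * W r' * (2 * #|asg|%:R) * (2 * Y))).
  by apply: ler_wpM2l => //; rewrite !mulr_ge0 // ler0n.
apply: ler_wpM2r; first by rewrite mulr_ge0.
(* The indicator [W r'] is bounded by 1; that of [r] is kept for the wire bound. *)
apply: ler_wpM2r => //; rewrite /W.
by do 2![case: (1 < _)%N]; rewrite /= ?mulr0 ?mul0r ?mulr1.
Qed.

End Restriction.

(** * Bounds on the collision mass *)

Section Mass.
Variables (R : realFieldType) (K Q : finType).
Implicit Type b : K -> Q -> R.

Local Notation q := (#|Q|%:R : R).

Definition block_support b (i : K) : nat := #|[set t | b i t != 0]|.

Lemma prod_growth (m : nat) : (2 * m <= #|Q|)%N ->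
  (q ^+ 2 + q) ^+ m <= 2 * q ^+ 2 ^+ m.
Proof.
case: (posnP #|Q|) => [->|q_gt0].
  by case: m => // _; rewrite !expr0; lra.
have q0 : 0 < q by rewrite ltr0n.
move=> mq; have {mq} : (2 * m)%:R <= q by rewrite ler_nat.
rewrite natrM => mq.
(* That is, [(1 + 1/q)^j <= 1 + 2j/q]; the induction step needs [2j <= q]. *)
have bern (j : nat) : (j <= m)%N ->
    q * (q ^+ 2 + q) ^+ j <= (q + 2 * j%:R) * q ^+ 2 ^+ j.
  elim: j => [_|j IH jm]; first by rewrite !expr0 mulr0 addr0.
  have jq : 2 * j%:R <= q :> R by apply: le_trans mq;
    rewrite ler_pM2l // ler_nat ltnW.
  rewrite exprS mulrCA; apply: le_trans (ler_wpM2l _ (IH (ltnW jm))) _.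
    by rewrite addr_ge0 ?exprn_ge0 // ltW.
  rewrite [in leRHS]exprS !mulrA; apply: ler_wpM2r;
    first by rewrite !exprn_ge0 // ltW.
  rewrite -natr1; have := ler_wpM2r (ltW q0) jq; nra.
have := bern m (leqnn m) => /le_trans /(_ (ler_wpM2r _ _)) H.
have {}H : q * (q ^+ 2 + q) ^+ m <= (2 * q) * q ^+ 2 ^+ m.
  by apply: H; [rewrite !exprn_ge0 // ltW | lra].
by rewrite -(ler_pM2l q0); apply: le_trans H _; rewrite mulrCA mulrA.
Qed.

Lemma sum_nonzero b i : \sum_t (b i t != 0)%:R = (block_support b i)%:R :> R.
Proof. by rewrite -natr_sum -big_mkcond sum1_card /block_support cardsE. Qed.

Lemma sum_coll_row b i t : \sum_t' coll b i t t' = (b i t != 0)%:R.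
Proof.
rewrite (bigD1 t) //= /coll eqxx big1 ?addr0 // => t'.
by rewrite eq_sym => /negbTE ->.
Qed.

Lemma sum_coll b i : \sum_t \sum_t' coll b i t t' = (block_support b i)%:R.
Proof. by under eq_bigr do rewrite sum_coll_row; exact: sum_nonzero. Qed.

Lemma sum_1coll b i : \sum_t \sum_t' (1 + coll b i t t') <= q ^+ 2 + q.
Proof.
under eq_bigr do rewrite big_split sumr_const /=.
rewrite big_split sumr_const sum_coll expr2 mulr_natr lerD2l ler_nat.
exact: max_card.
Qed.

Lemma sum_hit_1coll b i :
  \sum_t \sum_t' (b i t != 0)%:R * (1 + coll b i t t') <= 2 * q *
    (block_support b i)%:R.
Proof.
have [q0|q0] := posnP #|Q|.
  by rewrite big1 ?q0 ?mulr0 ?mul0r // => t; have := fintype0 t q0.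
have -> : 2 * q * (block_support b i)%:R = \sum_t (b i t != 0)%:R * (2 * q).
  by rewrite -mulr_suml sum_nonzero mulrC.
apply: ler_sum => t _; rewrite -mulr_sumr big_split sumr_const /= sum_coll_row.
apply: ler_wpM2l => //.
have : 1 <= q by rewrite ler1n.
by case: (b i t != 0) => /=; lra.
Qed.

Lemma coll_ge0 b i t t' : 0 <= coll b i t t'.
Proof. exact: ler0n. Qed.

Lemma prod_1coll b (P : pred K) (m : nat) : #|P| = m -> (2 * m <= #|Q|)%N ->
  \prod_(j | P j) \sum_t \sum_t' (1 + coll b j t t') <= 2 * q ^+ 2 ^+ m.
Proof.
move=> <- mq; apply: le_trans (prod_growth mq).
rewrite -prodr_const; apply: ler_prod => j _; rewrite sum_1coll andbT.
by apply: sumr_ge0 => t _; apply: sumr_ge0 => t' _;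
  rewrite addr_ge0 // coll_ge0.
Qed.

(** The condition of two hits is dropped. For each [i] the sum over [r] and [r'] factors over the
    blocks: block [i] contributes its support, and the others at most twice the number of pairs of
    positions. *)
Lemma coll_mass_gate b : (2 * #|K| <= #|Q|)%N ->
  q ^+ 2 * coll_mass b <= 2 * q ^+ 2 ^+ #|K| * (\sum_i block_support b i)%:R.
Proof.
move=> kq; rewrite natr_sum [leRHS]mulr_sumr.
apply: (@le_trans _ _ (q ^+ 2 * \sum_i \sum_(r : {ffun K ->
  Q}) \sum_(r' : {ffun K -> Q})
   \prod_j (if j == i then coll b j (r j) (r' j) else 1 + coll b j (r j) (r'
     j)))).
  apply: ler_wpM2l; first by rewrite exprn_ge0.
  rewrite /coll_mass [leRHS]exchange_big /=; apply: ler_sum => r _.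
  rewrite [leRHS]exchange_big /=; apply: ler_sum => r' _.
  rewrite mulr_sumr; apply: ler_sum => i _.
  rewrite [leRHS](bigD1 i) //= eqxx.
  rewrite [X in _ <= _ * X](eq_bigr (fun j => 1 + coll b j (r j) (r' j)));
    last first.
    by move=> j /negbTE ->.
  apply: ler_piMl; last by case: (_ < _)%N.
  rewrite mulr_ge0 ?coll_ge0 //; apply: prodr_ge0 => j _.
  by rewrite addr_ge0 // coll_ge0.
rewrite mulr_sumr; apply: ler_sum => i _.
rewrite (sum_prod_pair (fun j t t' =>
  if j == i then coll b j t t' else 1 + coll b j t t')).
rewrite (bigD1 i) //= eqxx sum_coll.
rewrite (eq_bigr (fun j => \sum_t \sum_t' (1 + coll b j t t'))); last first.
  by move=> j /negbTE ->.
have kK : #|predC1 i| = #|K|.-1 by rewrite cardC1.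
rewrite [_ * _%:R]mulrC mulrCA; apply: ler_wpM2l => //.
have K0 : (0 < #|K|)%N by apply/card_gt0P; exists i.
have -> : q ^+ 2 ^+ #|K| = q ^+ 2 * q ^+ 2 ^+ #|K|.-1 by rewrite -exprS prednK.
rewrite mulrCA; apply: ler_wpM2l; first by rewrite exprn_ge0.
by apply: prod_1coll kK _; apply: leq_trans kq; rewrite leq_mul2l leq_pred.
Qed.

(** A union bound over the second block that is hit. *)
Lemma two_hits b (r : {ffun K -> Q}) i : b i (r i) != 0 ->
  (1 < #|hits b r|)%:R <= \sum_(j | j != i) (b j (r j) != 0)%:R :> R.
Proof.
move=> bi; rewrite -natr_sum ler_nat.
case: ltnP => // H.
have iH : i \in hits b r by rewrite inE.
move: H; rewrite (cardsD1 i) iH => H.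
have /card_gt0P[j] : (0 < #|hits b r :\ i|)%N by [].
by rewrite !inE => /andP[ji bj]; rewrite (bigD1 j) //= bj.
Qed.

(** Here the condition of two hits pays: besides the collision in block [i], some block [j] is hit,
    which has probability (support of [j]) / q. The bound becomes quadratic in the support, so that
    its square root is linear in the fan-in. *)
Lemma coll_mass_wire b : (2 * #|K| <= #|Q|)%N ->
  q ^+ 3 * coll_mass b <= 4 * q ^+ 2 ^+ #|K| * (\sum_i block_support b i)%:R ^+
    2.
Proof.
move=> kq.
(* Block [i] collides, block [j] is hit by [r], and the remaining blocks are unconstrained. *)
pose f i j l t t' := if l == i then coll b l t t' else
   if l == j then (b l t != 0)%:R * (1 + coll b l t t') else 1 + coll b l t t'.
apply: (@le_trans _ _ (q ^+ 3 * \sum_i \sum_(j | j != i)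
   \sum_(r : {ffun K -> Q}) \sum_(r' : {ffun K ->
     Q}) \prod_l f i j l (r l) (r' l))).
  apply: ler_wpM2l; first by rewrite exprn_ge0.
  under [leRHS]eq_bigr => i _.
    rewrite exchange_big /=.
    under eq_bigr => r _ do rewrite exchange_big /=.
    over.
  rewrite /coll_mass [leRHS]exchange_big /=; apply: ler_sum => r _.
  rewrite [leRHS]exchange_big /=; apply: ler_sum => r' _.
  rewrite mulr_sumr; apply: ler_sum => i _.
  rewrite [leRHS](eq_bigr (fun j =>
    (b j (r j) != 0)%:R * (coll b i (r i) (r' i) *
     \prod_(l | l != i) (1 + coll b l (r l) (r' l))))); last first.
    move=> j ji; rewrite (bigD1 i) //= /f eqxx mulrCA; congr (_ * _).
    rewrite (bigD1 j) //= [in RHS](bigD1 j) //= (negbTE ji) eqxx -mulrA;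
      congr (_ * (_ * _)).
    by apply: eq_bigr => l /andP[/negbTE -> /negbTE ->].
  rewrite -mulr_suml.
  case: (eqVneq (b i (r i)) 0) => [bi|bi].
    by rewrite /coll bi eqxx andbF !mul0r !mulr0.
  apply: ler_wpM2r; last exact: two_hits.
  rewrite mulr_ge0 ?coll_ge0 //; apply: prodr_ge0 => j _.
  by rewrite addr_ge0 // coll_ge0.
rewrite natr_sum [leLHS]mulr_sumr (expr2 (\sum_i (block_support b i)%:R))
  mulr_suml [leRHS]mulr_sumr; apply: ler_sum => i _.
apply: (@le_trans _ _ (\sum_(j | j != i) 4 * q ^+ 2 ^+ #|K| * ((block_support b
  i)%:R * (block_support b j)%:R))).
  rewrite mulr_sumr; apply: ler_sum => j ji.
  rewrite (sum_prod_pair (f i j)) (bigD1 i) //= (bigD1 j) //= /f eqxx (negbTE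
    ji) eqxx sum_coll.
  rewrite (eq_bigr (fun j => \sum_t \sum_t' (1 + coll b j t t'))); last first.
    by move=> l /andP[/negbTE -> /negbTE ->].
  have K0 : (0 < #|K|)%N by apply/card_gt0P; exists i.
  have kK : #|[pred l | (l != i) && (l != j)]| = #|K|.-2.
    have := cardC [set i; j]; rewrite cards2 eq_sym ji => /= kK.
    rewrite -kK /=; apply: eq_card => l; by rewrite !inE negb_or.
  have K2 : (1 < #|K|)%N.
    by have := max_card [set i; j]; rewrite cards2 eq_sym ji.
  have -> : q ^+ 2 ^+ #|K| = q ^+ 2 * (q ^+ 2 * q ^+ 2 ^+ #|K|.-2).
    by rewrite -!exprS; case: #|K| K2 => [|[|]].
  rewrite mulrCA (_ : 4 * _ * _ = (block_support b i)%:R * (q ^+ 3 * ((2 * q *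
    (block_support b j)%:R) *
     (2 * q ^+ 2 ^+ #|K|.-2)))); last by ring.
  apply: ler_wpM2l => //; apply: ler_wpM2l; first by rewrite exprn_ge0.
  apply: ler_pM.
  - apply: sumr_ge0 => t _; apply: sumr_ge0 => t' _.
    by rewrite mulr_ge0 // addr_ge0 // coll_ge0.
  - apply: prodr_ge0 => l _; apply: sumr_ge0 => t _; apply: sumr_ge0 => t' _.
    by rewrite addr_ge0 // coll_ge0.
  - exact: sum_hit_1coll.
  apply: prod_1coll kK _; apply: leq_trans kq.
  by rewrite leq_mul2l -!subn1 -subnDA leq_subr.
rewrite -!mulr_sumr; apply: ler_wpM2l; first by rewrite mulr_ge0 ?exprn_ge0.
apply: ler_wpM2l => //.
by rewrite [leRHS](bigD1 i) //= lerDr.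
Qed.

End Mass.

(** * Counting threshold functions *)

Section Chow.
Variables (R : realFieldType) (X : finType).

(** The inputs are arbitrary Boolean features, so that one count serves both layers of gates. *)
Definition is_threshold (I : finType) (p : I -> X -> bool) (h : {ffun X ->
  bool}) :=
  exists (th : R) (w : I -> R), forall z, h z = (th <= \sum_i w i * (p i z)%:R).

Definition thresholds (I : finType) (p : I -> X -> bool) : {set {ffun X ->
  bool}} :=
  [set h | `[< is_threshold p h >]].

(* The sums are the Chow parameters of [h]. *)
Lemma chow_unique (I : finType) (p : I -> X -> bool) (h h' : {ffun X -> bool}) :
  is_threshold p h ->
  (forall i, \sum_z (h z && p i z) = \sum_z (h' z && p i z))%N ->
  (\sum_z h z = \sum_z h' z)%N -> h = h'.
Proof.
move=> [th [w hE]] eqp eq1.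
have natE (f : X -> bool) : (\sum_z f z)%:R = \sum_z (f z)%:R :> R by rewrite
  natr_sum.
pose v z := \sum_i w i * (p i z)%:R - th.
(* Equal Chow parameters make [h - h'] orthogonal to every affine form in the features, in
   particular to the one that defines [h]. *)
have sumv0 : \sum_z ((h z)%:R - (h' z)%:R) * v z = 0.
  under eq_bigr => z _ do rewrite mulrBr mulr_sumr.
  rewrite sumrB -mulr_suml sumrB -!natE eq1 subrr mul0r subr0 exchange_big /=.
  apply: big1 => i _.
  transitivity (w i * ((\sum_z (h z && p i z))%:R - (\sum_z (h' z && p i
    z))%:R)).
    rewrite !natE -sumrB mulr_sumr; apply: eq_bigr => z _.
    by rewrite mulrCA; do 3!case: (_ z) => /=; rewrite ?(mulr1, mulr0, subr0,
      sub0r, subrr, mul1r, mulN1r).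
  by rewrite eqp subrr mulr0.
(* [h] is 1 exactly where [v >= 0], so no term is negative and all of them vanish. *)
have termv z : 0 <= ((h z)%:R - (h' z)%:R) * v z.
  have := hE z; rewrite -subr_ge0 -/(v z).
  case: (h z) => /esym vz; case: (h' z);
    rewrite ?subrr ?mul0r // ?subr0 ?mul1r //.
  by rewrite sub0r mulN1r oppr_ge0 ltW // ltNge vz.
(* Where [h = 0] and [h' = 1], the vanishing term would force [v z = 0], whereas [h z = 0] means
   [v z < 0]. *)
have hh' z : h' z -> h z.
  have /eqP := sumv0; rewrite psumr_eq0 // => /allP/(_ z (mem_index_enum _)) /=.
  have := hE z; rewrite -subr_ge0 -/(v z).
  case: (h z) => // /esym vz /[swap] ->; rewrite sub0r mulN1r oppr_eq0 =>
    /eqP v0.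
  by rewrite v0 lexx in vz.
apply/ffunP => z; case h'z: (h' z); first exact: hh'.
apply/negP => hz; suff : (\sum_z h' z < \sum_z h z)%N by rewrite eq1 ltnn.
rewrite (bigD1 z) //= [ltnRHS](bigD1 z) //= hz h'z add0n ltnS leq_sum // =>
  z' _.
by case: (h' z') (hh' z') => // /(_ isT) ->.
Qed.

(** A threshold function is determined by its [#|I| + 1] Chow parameters, each between 0 and
    [#|X|]. *)
Lemma card_thresholds (I : finType) (p : I -> X -> bool) :
  (#|thresholds p| <= #|X|.+1 ^ #|I|.+1)%N.
Proof.
have bnd (P : pred X) : (\sum_z P z < #|X|.+1)%N.
  by rewrite ltnS -sum1_card leq_sum // => z _; case: (P z).
pose chow (h : {ffun X -> bool}) : {ffun option I -> 'I_#|X|.+1} :=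
  [ffun o => if o is Some i then Ordinal (bnd [pred z | h z && p i z])
             else Ordinal (bnd h)].
have inj : {in thresholds p &, injective chow}.
  move=> h h'; rewrite inE => /asboolP hT _ /ffunP E.
  apply: (chow_unique hT) => [i|].
    by have := E (Some i); rewrite !ffunE => /(congr1 val).
  by have := E None; rewrite !ffunE => /(congr1 val).
rewrite -(card_in_imset inj); apply: leq_trans (max_card _) _.
by rewrite card_ffun card_ord card_option.
Qed.

End Chow.

Section Depth2.
Variables (R : realFieldType) (k l : nat).
Let X : finType := k.-tuple bool.

Definition coord (i : 'I_k) (z : X) : bool := tnth z i.

Definition features (g : {ffun 'I_l -> {ffun X ->
  bool}}) (i : 'I_k + 'I_l) (z : X) :=
  match i with inl i => coord i z | inr j => g j z end.

Definition depth2 : {set {ffun X -> bool}} :=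
  \bigcup_(g in ffun_on (mem (thresholds R coord))) thresholds R (features g).

(** The exponent counts Chow parameters: [k + 1] for each of the [l] bottom gates and [k + l + 1]
    for the top gate. *)
Lemma card_depth2 : (#|depth2| <= (2 ^ k).+1 ^ ((k.+1 * l) + (k + l).+1))%N.
Proof.
have cX : #|X| = (2 ^ k)%N by rewrite card_tuple card_bool.
have -> : ((k.+1 * l) + (k + l).+1 = k.+1 * #|'I_l| + #|{: 'I_k + 'I_l}|.+1)%N.
  by rewrite card_sum !card_ord.
rewrite expnD expnM -{1}cX.
apply: (@leq_trans (\sum_(g in ffun_on (mem (thresholds R coord)))
    #|thresholds R (features g)|)%N).
  apply: (big_ind2 (fun (A : {set {ffun X -> bool}}) m => #|A| <= m)%N) => //.
    by rewrite cards0.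
  by move=> A m B m' Am Bm; rewrite cardsU (leq_trans (leq_subr _ _)) //
    leq_add.
have le_g (g : {ffun 'I_l -> {ffun X -> bool}}) :
    (#|thresholds R (features g)| <= (2 ^ k).+1 ^ #|{: 'I_k + 'I_l}|.+1)%N.
  by rewrite -cX card_thresholds.
pose A : {pred {ffun 'I_l -> {ffun X -> bool}}} :=
  ffun_on (mem (thresholds R coord)).
have := @leq_sum _ (index_enum _) (mem A) _ _ (fun g _ => le_g g).
move=> /leq_trans; apply.
rewrite sum_nat_const leq_mul2r; apply/orP; right.
have thr : (#|thresholds R coord| <= #|X|.+1 ^ k.+1)%N.
  by have := card_thresholds R coord; rewrite card_ord.
rewrite card_ffun_on; case: (posnP #|'I_l|) => [->|l0]; first by rewrite !expn0.
by rewrite leq_exp2r.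
Qed.

Lemma mem_depth2 (h : {ffun X -> bool}) (g : {ffun 'I_l -> {ffun X -> bool}}) :
  (forall j, is_threshold R coord (g j)) -> is_threshold R (features g) h ->
    h \in depth2.
Proof.
move=> gT hT; apply/bigcupP; exists g; last by rewrite inE; apply/asboolP.
by apply/ffun_onP => j; rewrite inE; apply/asboolP.
Qed.

End Depth2.

(** * Small bias and list decoding *)

Section SmallBias.
Variables (R : realFieldType) (f : nat -> {poly 'F_2}) (h n : nat).
Hypothesis f_irr : irreducible_poly (f h).
Hypothesis f_size : size (f h) = h.+1.

Lemma F2_neq0 (c : 'F_2) : c != 0 -> c = 1.
Proof. by case: c => [[|[|m]] i] // _; apply: val_inj. Qed.

Definition sgF2 (c : 'F_2) : R := (-1) ^+ (c == 1).

Lemma sgF2D (c d : 'F_2) : sgF2 (c + d) = sgF2 c * sgF2 d.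
Proof.
have F2D : (c + d == 1) = (c == 1) (+) (d == 1).
  case: (eqVneq c 0) => [->|/F2_neq0 ->]; first by rewrite add0r.
  by case: (eqVneq d 0) => [->|/F2_neq0 ->].
by rewrite /sgF2 F2D signr_addb.
Qed.

Lemma sgF2_sum (I : finType) (F : I ->
  'F_2) : sgF2 (\sum_i F i) = \prod_i sgF2 (F i).
Proof. exact: (big_morph sgF2 sgF2D (erefl _)). Qed.

Local Notation vec := {ffun 'I_h -> bool}.

Definition vpoly (u : vec) : {poly 'F_2} :=
  \poly_(j < h) (if insub j is Some i then (u i)%:R else 0).

Lemma coef_vpoly u (j : 'I_h) : (vpoly u)`_j = (u j)%:R.
Proof. by rewrite coef_poly ltn_ord valK. Qed.

Lemma vpoly_inj : injective vpoly.
Proof.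
move=> u v /polyP E; apply/ffunP => j; have := E j; rewrite !coef_vpoly.
by case: (u j); case: (v j).
Qed.

Lemma f_monic : monic_irreducible_poly (f h).
Proof.
split; first exact: f_irr.
apply/monicP/F2_neq0; rewrite lead_coef_eq0 -size_poly_eq0 f_size //.
Qed.

(** Composition modulo [f h] is evaluation in the field F_2[X] / (f h), where a nonzero polynomial
    has fewer roots than its size; distinct [u] give distinct elements, as [vpoly u] has degree
    below [h]. *)
Lemma card_roots (P : {poly 'F_2}) : P != 0 ->
  (#|[set u | ((P \Po vpoly u) %% f h == 0)%R]| < size P)%N.
Proof.
move=> P0; set S := [set u | _].
pose qT := {poly %/ f h with f_monic}.
pose Q : {poly qT} := map_poly (qfpoly_const f_monic) P.
have Q0 : Q != 0.
  apply: contraNneq P0 => Q0; apply/eqP/(@map_fpoly_div_inj _ _ f_monic).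
  by rewrite [LHS]Q0 [RHS]map_poly0.
pose rs : seq qT := [seq in_qpoly (f h) (vpoly u) | u <- enum S].
have -> : #|S| = size rs by rewrite size_map -cardE.
apply: leq_trans (size_poly _ _ : size Q <= size P)%N; apply: max_poly_roots =>
  //.
  apply/allP => _ /mapP[u + ->]; rewrite mem_enum inE => /eqP uS.
  apply/rootP; rewrite -[LHS](in_qpoly_comp_horner (f h) P (vpoly u)).
  apply: val_inj => /=; rewrite (mk_monicE f_monic) -Pdiv.IdomainMonic.modpE
    ?f_monic //.
rewrite map_inj_in_uniq ?enum_uniq // =>
  u v _ _ /(congr1 (fun p : {poly %/ f h} => polyn p)).
rewrite !in_qpoly_small ?(mk_monicE f_monic) ?f_size ?ltnS ?size_poly // => E.
exact: vpoly_inj.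
Qed.

Lemma sum_sgF2 (c : 'I_h -> 'F_2) : (exists j, c j != 0) ->
  \sum_(v : vec) sgF2 (\sum_j c j * (v j)%:R) = 0.
Proof.
move=> [j cj]; under eq_bigr do rewrite sgF2_sum.
rewrite -(bigA_distr_bigA (fun i (v : bool) =>
  sgF2 (c i * v%:R))) /= (bigD1 j) //=.
by rewrite big_bool /= (F2_neq0 cj) mul1r mulr0 /sgF2 /= expr1 expr0 addNr
  mul0r.
Qed.

Definition split_tuple (p : vec * vec) : (h + h).-tuple bool :=
  [tuple of [tuple p.1 i | i < h] ++ [tuple p.2 i | i < h]].

Lemma split_tuple_bij : bijective split_tuple.
Proof.
apply: inj_card_bij; last first.
  by rewrite card_prod !card_ffun card_tuple card_bool card_ord expnD.
move=> [u v] [u' v'] /(congr1 val) /= /eqP.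
rewrite eqseq_cat ?size_tuple // => /andP[/eqP E /eqP E'].
by congr pair; apply/ffunP => i; [have := congr1 (fun s => nth false s i) E
  | have := congr1 (fun s => nth false s i) E']; rewrite !nth_mktuple.
Qed.

Lemma nth_split_tuple_l p (j : 'I_h) : nth false (split_tuple p) j = p.1 j.
Proof. by rewrite nth_cat size_tuple ltn_ord nth_mktuple. Qed.

Lemma nth_split_tuple_r p (j : 'I_h) : nth false (split_tuple p) (h + j) = p.2
  j.
Proof. by rewrite nth_cat size_tuple ltnNge leq_addr addKn nth_mktuple. Qed.

Lemma lo_elt_split p : lo_elt h (split_tuple p) = vpoly p.1.
Proof.
apply/polyP => j; rewrite !coef_poly; case: ltnP => // jh.
by rewrite insubT /= -(nth_split_tuple_l p).
Qed.

(** By linearity the powers of [u] combine to P(u), where P is the polynomial with coefficients [c];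
    the entry is the inner product of P(u) and [v]. *)
Lemma aghp_mulE (c : 'cV['F_2]_n) (u v : vec) :
  (aghp_mx f (h + h) n *m c) (enum_rank (split_tuple (u, v))) ord0 =
  \sum_(j < h) ((rVpoly c^T \Po vpoly u) %% f h)`_j * (v j)%:R.
Proof.
have hh : (h + h)./2 = h by rewrite addnn doubleK.
have modE : (rVpoly c^T \Po vpoly u) %% f h =
    \sum_(i < n) c i ord0 *: (vpoly u ^+ i %% f h).
  rewrite /rVpoly poly_def raddf_sum (big_morph _ (modpD (f h)) (mod0p _)) /=.
  apply: eq_bigr => i _.
  by rewrite valK mxE comp_polyZ comp_Xn_poly modpZl.
rewrite mxE modE; under eq_bigr =>
  i _ do rewrite mxE /= enum_rankK hh lo_elt_split mulr_suml.
rewrite exchange_big /=; apply: eq_bigr => j _.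
rewrite coef_sum mulr_suml; apply: eq_bigr => i _.
by rewrite coefZ coef_poly ltn_ord nth_split_tuple_r /= mulrAC [c i _ * _]mulrC.
Qed.

(** For fixed [u] the sum over [v] is 0 unless P(u) = 0, when it is [2 ^+ h]; P has fewer than [n]
    roots. *)
Lemma aghp_small_bias (c : 'cV['F_2]_n) : c != 0 ->
  `|\sum_(z : (h + h).-tuple bool) sgF2 ((aghp_mx f (h + h) n *m c) (enum_rank
    z) ord0)|
    <= n%:R * 2 ^+ h.
Proof.
move=> c0; set P := rVpoly c^T.
have P0 : P != 0.
  by apply: contraNneq c0 => P0;
    rewrite -(trmxK c) -(rVpolyK c^T) -/P P0 linear0 trmx0.
rewrite (reindex split_tuple) /=; last exact/onW_bij/split_tuple_bij.
rewrite -(pair_big xpredT xpredT (fun u v =>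
  sgF2 ((aghp_mx f (h + h) n *m c) (enum_rank (split_tuple (u, v))) ord0))) /=.
pose S : {set vec} := [set u | ((P \Po vpoly u) %% f h == 0)%R].
apply: le_trans (ler_norm_sum _ _ _) _.
apply: (@le_trans _ _ (\sum_(u in S) 2 ^+ h)); last first.
  rewrite sumr_const -[leLHS]mulr_natl ler_wpM2r ?exprn_ge0 // ler_nat.
  by apply: ltnW; apply: leq_trans (card_roots P0) (size_poly _ _).
rewrite [leRHS]big_mkcond /=; apply: ler_sum => u _; rewrite inE.
under eq_bigr do rewrite aghp_mulE -/P.
case: eqP => [->|/eqP Pu].
  apply: le_trans (ler_norm_sum _ _ _) _.
  rewrite (eq_bigr (fun=> 1)) => [|v _].
    by rewrite sumr_const card_ffun card_bool card_ord natrX.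
  by rewrite normr_sign.
rewrite sum_sgF2 ?normr0 //.
have : exists j, ((P \Po vpoly u) %% f h)`_j != 0.
  by exists (size ((P \Po vpoly u) %% f h)).-1;
    rewrite -lead_coefE lead_coef_eq0.
(* A remainder modulo [f h] has at most [h] coefficients. *)
move=> [j cj]; suff jh : (j < h)%N by exists (Ordinal jh).
rewrite ltnNge; apply: contra cj => hj; rewrite nth_default //.
apply: leq_trans hj; rewrite -ltnS -f_size ltn_modp -size_poly_eq0 f_size //.
Qed.

Local Notation k := (h + h)%N.
Local Notation bits x := (\col_(i < n) (tnth x i)%:R : 'cV['F_2]_n).

Definition zeros : n.-tuple bool := [tuple of nseq n false].

Lemma bits_add_eq0 (x y : n.-tuple bool) : bits x + bits y = 0 -> x = y.
Proof.
move=> /matrixP E; apply: eq_from_tnth => i; have := E i ord0; rewrite !mxE.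
by case: (tnth x i); case: (tnth y i).
Qed.

Lemma bits_zeros : bits zeros = 0.
Proof. by apply/matrixP => i j; rewrite !mxE tnth_nseq. Qed.

Lemma F_fun_small_bias (x y : n.-tuple bool) : x != y ->
  `|\sum_(z : k.-tuple bool) (-1) ^+ F_fun f z x * (-1) ^+ F_fun f z y| <= n%:R
    * 2 ^+ h :> R.
Proof.
move=> xy; have /aghp_small_bias : bits x + bits y != 0.
  by apply: contraNneq xy => /bits_add_eq0 ->.
by under eq_bigr do rewrite mulmxDr mxE sgF2D.
Qed.

(** The case [y = zeros] of the preceding bound, since the code word of the zero vector is 0. *)
Lemma F_fun_balanced (x : n.-tuple bool) : x != zeros ->
  `|\sum_(z : k.-tuple bool) (-1) ^+ F_fun f z x| <= n%:R * 2 ^+ h :> R.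
Proof.
move=> /F_fun_small_bias; congr (`|_| <= _); apply: eq_bigr => z _.
by rewrite [F_fun f z zeros]/F_fun bits_zeros mulmx0 mxE mulr1.
Qed.

End SmallBias.

Section Johnson.
Variables (R : realFieldType) (T Z : finType).

(* Expand the squared norm of \sum_(x in S) v x. *)
Lemma johnson_bound (S : {set T}) (v : T -> Z -> R) (G : Z -> R) (gam del : R) :
  (forall x z, v x z ^+ 2 = 1) -> (forall z, G z ^+ 2 = 1) -> 0 <= gam ->
    0 <= del ->
  {in S &, forall x y, x != y -> \sum_z v x z * v y z <= del} ->
  {in S, forall x, gam <= \sum_z G z * v x z} ->
  #|S|%:R ^+ 2 * gam ^+ 2 <= #|Z|%:R * (#|S|%:R * #|Z|%:R + #|S|%:R ^+ 2 * del).
Proof.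
move=> v1 G1 gam0 del0 small corr.
have gamS : #|S|%:R * gam <= \sum_z G z * \sum_(x in S) v x z.
  under eq_bigr do rewrite mulr_sumr.
  rewrite exchange_big /= -sum1_card natr_sum mulr_suml.
  by apply: ler_sum => x xS; rewrite mul1r corr.
rewrite -exprMn; apply: (@le_trans _ _ ((\sum_z G z * \sum_(x in S) v x z) ^+
  2)).
  by rewrite ler_sqr ?nnegrE // ?(le_trans _ gamS) // mulr_ge0.
apply: le_trans (cauchy_schwarz _ _) _.
rewrite (eq_bigr (fun=> 1)); last by move=> z _; rewrite G1.
rewrite sumr_const; apply: ler_wpM2l => //.
have -> : \sum_z (\sum_(x in S) v x z) ^+ 2 =
    \sum_(x in S) \sum_(y in S) \sum_z v x z * v y z.
  under eq_bigr do rewrite expr2 mulr_suml.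
  rewrite exchange_big /=; apply: eq_bigr => x _.
  under eq_bigr do rewrite mulr_sumr.
  by rewrite exchange_big.
have -> : #|S|%:R * #|Z|%:R + #|S|%:R ^+ 2 * del =
   \sum_(x in S) (#|Z|%:R + \sum_(y in S) del).
  by rewrite !sumr_const -[RHS]mulr_natl mulrDr -[del *+ _]mulr_natl mulrA
    expr2.
(* The diagonal term contributes [#|Z|], each other one at most [del]. *)
apply: ler_sum => x xS; rewrite (bigD1 x) //=; apply: lerD.
  by under eq_bigr do rewrite -expr2 v1; rewrite sumr_const.
rewrite [leRHS](bigD1 x) //= -[leLHS]add0r; apply: lerD => //.
by apply: ler_sum => y /andP[yS yx]; rewrite small // eq_sym.
Qed.

End Johnson.

(** * Layout of the inputs *)

Section Affine.
Variables (R : realFieldType) (k : nat).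

Definition is_affine (phi : k.-tuple bool -> R) :=
  exists (c0 : R) (c : 'I_k -> R),
    forall z, phi z = c0 + \sum_i c i * (tnth z i)%:R.

Lemma affine_ext phi psi : phi =1 psi -> is_affine phi -> is_affine psi.
Proof. by move=> E [c0 [c H]]; exists c0, c => z; rewrite -E. Qed.

Lemma affine_cst a : is_affine (fun=> a).
Proof. by exists a, (fun=> 0) => z; rewrite big1 ?addr0 // => i _;
  rewrite mul0r. Qed.

Lemma affineD phi psi : is_affine phi -> is_affine psi ->
  is_affine (fun z => phi z + psi z).
Proof.
move=> [a0 [a Ha]] [b0 [b Hb]]; exists (a0 + b0), (fun i => a i + b i) => z.
rewrite Ha Hb addrACA; congr (_ + _); rewrite -big_split /=.
by apply: eq_bigr => i _; rewrite mulrDl.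
Qed.

Lemma affineZ a phi : is_affine phi -> is_affine (fun z => a * phi z).
Proof.
move=> [c0 [c H]]; exists (a * c0), (fun i => a * c i) => z.
by rewrite H mulrDr mulr_sumr; congr (_ + _); apply: eq_bigr => i _;
  rewrite mulrA.
Qed.

Lemma affine_sum (I : finType) (P : pred I) (F : I -> k.-tuple bool -> R) :
  (forall i, P i -> is_affine (F i)) -> is_affine (fun z =>
    \sum_(i | P i) F i z).
Proof.
move=> H; elim: (index_enum I) => [|i s IH].
  by apply: affine_ext (affine_cst 0) => z; rewrite big_nil.
case Pi: (P i); last by apply: affine_ext IH => z; rewrite big_cons Pi.
by apply: affine_ext (affineD (H i Pi) IH) => z; rewrite big_cons Pi.
Qed.

Lemma affine_xor i (s : bool) : is_affine (fun z => (tnth z i (+) s)%:R).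
Proof.
exists s%:R, (fun j => if j == i then (-1) ^+ s else 0) => z.
rewrite (bigD1 i) //= eqxx big1 ?addr0 => [|j /negbTE ->];
  last by rewrite mul0r.
by case: s; case: (tnth z i);
  rewrite /= ?expr0 ?expr1 ?mulN1r ?subrr ?oppr0 ?mul1r ?mulr0 ?addr0 ?add0r.
Qed.

Lemma affine_threshold (th : R) phi :
  is_affine phi -> is_threshold R (@coord k) [ffun z => th <= phi z].
Proof.
move=> [c0 [c H]]; exists (th - c0), c => z.
by rewrite ffunE H lerBlDl.
Qed.

(** The affine part goes into the threshold and the direct wires of the top gate, so only the gates
    in [P] are charged. *)
Lemma depth2_intro (l : nat) (th : R) (phi : k.-tuple bool -> R)
    (B : finType) (P : pred B) (w : B -> R) (g : B -> {ffun k.-tuple bool ->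
      bool}) :
  is_affine phi -> (forall b, P b -> is_threshold R (@coord k) (g b)) ->
  (#|P| <= l)%N ->
  [ffun z => th <= phi z + \sum_(b | P b) w b * (g b z)%:R] \in depth2 R k l.
Proof.
move=> [c0 [c phiE]] gT Pl.
(* Padding up to exactly [l] gates; it receives weight 0. *)
pose g0 : {ffun k.-tuple bool -> bool} := [ffun z => 0 <= 0 :> R].
have g0T : is_threshold R (@coord k) g0 by exact: affine_threshold (affine_cst
  0).
pose s := [seq (w b, g b) | b <- enum P].
have sl : (size s <= l)%N by rewrite size_map -cardE.
pose G : {ffun 'I_l -> {ffun k.-tuple bool -> bool}} := [ffun j : 'I_l =>
  (nth (0, g0) s j).2].
apply: (@mem_depth2 _ _ _ _ G) => [j|].
  rewrite ffunE; case: (ltnP j (size s)) => js; last by rewrite nth_default.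
  have /mapP[b + ->] := mem_nth (0, g0) js.
  by rewrite mem_enum => /gT.
exists (th - c0), (fun i => match i with inl i => c i | inr j => (nth (0,
  g0) s (j : 'I_l)).1 end) => z.
rewrite ffunE phiE big_sumType /= -addrA -lerBlDl; congr (_ <= _ + _).
under [RHS]eq_bigr do rewrite ffunE.
have -> : \sum_(b | P b) w b * (g b z)%:R = \sum_(b <- enum P) w b * (g b z)%:R.
  by rewrite big_enum.
rewrite -(big_map (fun b => (w b, g b)) xpredT (fun p => p.1 * (p.2 z)%:R)).
rewrite -/s (big_nth (0, g0)) big_mkord.
rewrite (big_ord_widen _ (fun j => (nth (0, g0) s j).1 * ((nth (0,
  g0) s j).2 z)%:R) sl).
rewrite big_mkcond; apply: eq_bigr => j _.
by case: ltnP => // js; rewrite nth_default // mul0r.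
Qed.

End Affine.

Section Layout.
Variables (k q : nat).

Lemma idx_proof (i : 'I_k) (t : 'I_q) : (i * q + t < k * q)%N.
Proof.
apply: (@leq_trans (i * q + q)); first by rewrite ltn_add2l.
by rewrite addnC -mulSn leq_mul2r ltn_ord orbT.
Qed.

Definition idx (p : 'I_k * 'I_q) : 'I_(k * q) := Ordinal (idx_proof p.1 p.2).

Lemma row_proof (j : 'I_(k * q)) : (j %/ q < k)%N.
Proof. by rewrite ltn_divLR //; case: q j => [|//] [j]; rewrite muln0. Qed.

Lemma col_proof (j : 'I_(k * q)) : (j %% q < q)%N.
Proof. by rewrite ltn_mod; case: q j => [|//] [j]; rewrite muln0. Qed.

Definition unidx (j : 'I_(k * q)) : 'I_k * 'I_q :=
  (Ordinal (row_proof j), Ordinal (col_proof j)).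

Lemma unidxK : cancel unidx idx.
Proof. by move=> j; apply: val_inj; rewrite /= -divn_eq. Qed.

Lemma idxK : cancel idx unidx.
Proof.
move=> [i t]; have q0 : (0 < q)%N by case: q t => [[]|].
congr pair; apply: val_inj => /=.
  by rewrite divnMDl // divn_small ?addn0.
by rewrite modnMDl modn_small.
Qed.

Lemma big_idx (V : Type) (e : V) (op : Monoid.com_law e) (F : 'I_(k * q) -> V) :
  \big[op/e]_j F j = \big[op/e]_i \big[op/e]_t F (idx (i, t)).
Proof.
rewrite (reindex idx) /=; last by exists unidx => j _; rewrite ?idxK ?unidxK.
by rewrite pair_bigA; apply: eq_bigr => -[].
Qed.

Local Notation asg := {ffun 'I_k -> {ffun 'I_q -> bool}}.
Local Notation n := (k * q)%N.

Definition flat (a : asg) : n.-tuple bool :=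
  [tuple a (unidx j).1 (unidx j).2 | j < n].

Lemma flat_idx a i t : tnth (flat a) (idx (i, t)) = a i t.
Proof. by rewrite tnth_mktuple idxK. Qed.

Definition concat (x y : n.-tuple bool) : (n + n).-tuple bool :=
  [tuple match fintype.split i with inl j => tnth x j | inr j =>
    tnth y j end | i < n + n].

Lemma concat_l x y j : tnth (concat x y) (lshift n j) = tnth x j.
Proof. by rewrite tnth_mktuple -[lshift n j]/(unsplit (inl j)) unsplitK. Qed.

Lemma concat_r x y j : tnth (concat x y) (rshift n j) = tnth y j.
Proof. by rewrite tnth_mktuple -[rshift n j]/(unsplit (inr j)) unsplitK. Qed.

(** For length [k * q] the i-th interval of consecutive bits is exactly row [i] of the index
    grid. *)
Lemma block_parities_flat (a : asg) (z : k.-tuple bool) :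
  (forall i, odd (\sum_t a i t)%N = tnth z i) -> block_parities k (flat a) = z.
Proof.
move=> H; apply: eq_from_tnth => i; rewrite tnth_mktuple -H; congr odd.
have k0 : (0 < k)%N by case: k i => [[]|].
rewrite mulKn // big_mkcond big_idx (bigD1 i) //= [X in (_ + X)%N]big1 ?addn0.
  apply: eq_bigr => t _; rewrite flat_idx /= mulnS [(q * i)%N]mulnC leq_addr.
  by rewrite [(q + _)%N]addnC ltn_add2l ltn_ord.
move=> j ji; apply: big1 => t _; case: ifP => // /andP[H1 H2].
case/eqP: ji; apply: val_inj => /=.
have := congr1 (fun p => val p.1) (idxK (j, t)) => /= <-.
apply/eqP; rewrite eqn_leq -ltnS ltn_divLR ?leq_divRL ?(leq_trans _ (ltn_ord
  t)) //.
by rewrite [(i.+1 * q)%N]mulnC H2 mulnC H1.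
Qed.

End Layout.

(** * Restricted circuits *)

Section RestrictedCircuit.
Variables (R : realType) (k q : nat).
Local Notation n := (k * q)%N.
Local Notation asg := {ffun 'I_k -> {ffun 'I_q -> bool}}.
Variable C : maj_ltf_ltf R (n + n).

Definition input (x : n.-tuple bool) (a : asg) : (n + n).-tuple bool :=
  concat x (flat a).

Definition block_weight (g : ltf R 'I_(n + n)) (i : 'I_k) (t : 'I_q) : R :=
  weight g (rshift n (idx (i, t))).

Definition residual (g : ltf R 'I_(n + n)) (x : n.-tuple bool) : R :=
  threshold g - \sum_(j < n) weight g (lshift n j) * (tnth x j)%:R.

Lemma sum_input (w : 'I_(n + n) -> R) x (a : asg) :
  \sum_v w v * (tnth (input x a) v)%:R =
  \sum_(j < n) w (lshift n j) * (tnth x j)%:R +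
  lin (fun i t => w (rshift n (idx (i, t)))) a.
Proof.
rewrite big_split_ord /=; congr (_ + _).
  by apply: eq_bigr => j _; rewrite concat_l.
rewrite big_idx; apply: eq_bigr => i _; apply: eq_bigr => t _.
by rewrite concat_r flat_idx.
Qed.

Lemma ltf_eval_input g x (a : asg) :
  ltf_eval g (tnth (input x a)) = fires (block_weight g) (residual g x) a.
Proof. by rewrite /ltf_eval sum_input /fires lerBlDl. Qed.

Definition parity_rest (r : {ffun 'I_k -> 'I_q}) (a : asg) (i : 'I_k) : bool :=
  odd (\sum_(t | t != r i) a i t).

Definition aim (r : {ffun 'I_k -> 'I_q}) (a : asg) (z : k.-tuple bool) : asg :=
  plug r [ffun i => tnth z i (+) parity_rest r a i] a.

Lemma block_parities_aim r a z : block_parities k (flat (aim r a z)) = z.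
Proof.
apply: block_parities_flat => i;
  rewrite (bigD1 (r i)) //= !ffunE eqxx oddD oddb.
rewrite (eq_bigr (fun t => a i t : nat)) ?addbK // => t /negbTE ne.
by rewrite !ffunE ne.
Qed.

(** This holds for every restriction, so the restriction may be chosen depending on [x] to suit the
    circuit. *)
Lemma B_fun_aim f x r a z :
  B_fun f k (input x (aim r a z)) = F_fun f z x.
Proof.
rewrite /B_fun; congr F_fun; last by apply: eq_from_tnth => j;
  rewrite tnth_mktuple concat_l.
rewrite -[RHS](block_parities_aim r a); congr block_parities.
by apply: eq_from_tnth => j; rewrite tnth_mktuple concat_r.
Qed.

Lemma affine_aim_bits r a (c : 'I_k -> R) :
  is_affine (fun z => \sum_i c i *
    ([ffun i => tnth z i (+) parity_rest r a i] i)%:R).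
Proof.
apply: affine_sum => i _; apply: affineZ.
by apply: affine_ext (affine_xor R i (parity_rest r a i)) => z; rewrite ffunE.
Qed.

Lemma affine_lin_aim r a b : is_affine (fun z => lin b (aim r a z) : R).
Proof.
apply: affine_ext (affineD (affine_cst k (rest b r a))
  (affine_aim_bits r a (fun i => b i (r i)))) => z.
by rewrite /aim lin_plug.
Qed.

(** The free bits are affine in [z], hence so are the direct wires and the gates that are not bad.
    The bad gates remain threshold functions of [z] and are the only ones to be counted. *)
Lemma out_value_depth2 x r a l (c : 'I_(nout C)) :
  (#|[pred b : 'I_(nbottom C) | bad (block_weight (bottom_gate b)) (residual
    (bottom_gate b) x) r a]| <= l)%N ->
  [ffun z => out_value (input x (aim r a z)) c] \in depth2 R k l.
Proof.
set P := [pred b | _] => Pl.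
pose w i := weight (out_gate c) i.
pose g (b : 'I_(nbottom C)) := [ffun z =>
  ltf_eval (bottom_gate b) (tnth (input x (aim r a z)))].
have gT b : P b -> is_threshold R (@coord k) (g b).
  move=> _; have := affine_threshold (residual (bottom_gate b) x)
    (affine_lin_aim r a (block_weight (bottom_gate b))).
  by congr is_threshold; apply/ffunP => z; rewrite !ffunE ltf_eval_input.
pose direct z := \sum_v w (inl v) * (tnth (input x (aim r a z)) v)%:R.
pose tame z := \sum_(b | ~~ P b) w (inr b) * (g b z)%:R.
have directA : is_affine direct.
  pose c0 := \sum_(j < n) w (inl (lshift n j)) * (tnth x j)%:R.
  apply: affine_ext (affineD (affine_cst k c0)
    (affine_lin_aim r a (fun i t => w (inl (rshift n (idx (i, t))))))) => z.
  by rewrite /direct (sum_input (fun v => w (inl v))).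
have tameA : is_affine tame.
  apply: (affine_sum (P := predC P) (F := fun b z =>
    w (inr b) * (g b z)%:R)) => b /not_bad_affine[c0 [cf H]].
  apply: (affineZ (w (inr b)) (phi := fun z => (g b z)%:R)).
  apply: affine_ext (affineD (affine_cst k c0) (affine_aim_bits r a cf)) => z.
  by rewrite ffunE ltf_eval_input /aim H.
have := depth2_intro (threshold (out_gate c)) (fun b =>
  w (inr b)) (affineD directA tameA) gT Pl.
set H := (X in X \in _); suff <- : H = [ffun z =>
  out_value (input x (aim r a z)) c] by [].
apply/ffunP => z; rewrite !ffunE /out_value /ltf_eval big_sumType /=.
congr (_ <= _); rewrite -addrA; congr (_ + _).
rewrite [RHS](bigID P) addrC /=.
by congr (_ + _); apply: eq_bigr => b _; rewrite ffunE.
Qed.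

End RestrictedCircuit.

(** * Counting the vectors through their code words *)

Section Counting.
Variables (R : realType) (f : nat -> {poly 'F_2}) (h q : nat).
Hypothesis f_irr : irreducible_poly (f h).
Hypothesis f_size : size (f h) = h.+1.
Local Notation k := (h + h)%N.
Local Notation n := (k * q)%N.
Variable C : maj_ltf_ltf R (n + n).
Hypothesis C_computes : computes C (B_fun f k).
Variables (T l : nat).
Hypothesis T_gt0 : (0 < T)%N.
Hypothesis nout_le : (nout C <= T)%N.
Hypothesis T_le : (32 * T ^ 2 * n <= 2 ^ h)%N.

Definition agreement (H : {ffun k.-tuple bool ->
  bool}) (x : n.-tuple bool) : R :=
  \sum_z (-1) ^+ H z * (-1) ^+ F_fun f z x.

Let m : R := 2 ^+ h * 2 ^+ h.

(** The bias of the code is half the square of the correlation [1 / (4T)] sought below, the margin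
    that the Johnson bound needs. *)
Let del_le : n%:R * 2 ^+ h <= m / (32 * T%:R ^+ 2).
Proof.
rewrite ler_pdivlMr ?mulr_gt0 ?exprn_gt0 ?ltr0n // mulrAC /m ler_pM2r
  ?exprn_gt0 //.
by rewrite mulrC -!natrX -!natrM ler_nat.
Qed.

Let m_gt0 : 0 < m.
Proof. by rewrite mulr_gt0 ?exprn_gt0. Qed.

Let card_z : #|{: k.-tuple bool}|%:R = m.
Proof. by rewrite card_tuple card_bool natrX exprD. Qed.

(** Summed over the output gates, the agreement with the code word is at least the number of [z]
    with [F = 0]. By balance this is at least [m / 4], and some gate reaches the average. *)
Lemma discriminator x r a : x != zeros n ->
  exists c : 'I_(nout C), m / (4 * T%:R) <=
    agreement [ffun z => out_value (input x (aim r a z)) c] x.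
Proof.
move=> x0; pose H (c : 'I_(nout C)) := [ffun z =>
  out_value (input x (aim r a z)) c].
(* Ties count as 1, so the surplus of correct votes is at least 0 where [F = 1] and at least 1 where
   [F = 0]. *)
have vote z : (~~ F_fun f z x)%:R <=
    \sum_(c < nout C) (-1) ^+ H c z * (-1) ^+ F_fun f z x :> R.
  have -> : \sum_(c < nout C) (-1) ^+ H c z * (-1) ^+ F_fun f z x =
      (-1) ^+ F_fun f z x * ((nout C)%:R - 2 * (\sum_c H c z)%:R) :> R.
    rewrite -mulr_suml mulrC; congr (_ * _).
    rewrite natr_sum mulr_sumr -[X in X%:R]card_ord -sum1_card natr_sum -sumrB.
    by apply: eq_bigr => c _; case: (H c z) => /=; rewrite ?expr1 ?expr0; ring.
  have := C_computes (input x (aim r a z)); rewrite B_fun_aim /circuit_eval.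
  have -> : (\sum_(c < nout C) out_value (input x (aim r a z)) c = \sum_c H c
    z)%N.
    by apply: eq_bigr => c _; rewrite ffunE.
  case: (F_fun f z x) => /=; first by rewrite -(ler_nat R) natrM expr1; lra.
  by move/negbT; rewrite -ltnNge -(ler_nat R) -natr1 natrM expr0; lra.
have sum_ge : m / 4 <= \sum_(c < nout C) agreement (H c) x.
  rewrite exchange_big /=; apply: le_trans (ler_sum _ (fun z _ => vote z)).
  have := F_fun_balanced R f_irr f_size x0.
  have -> : \sum_(z : k.-tuple bool) (-1) ^+ F_fun f z x =
      2 * \sum_(z : k.-tuple bool) (~~ F_fun f z x)%:R - m.
    rewrite mulr_sumr -card_z -sum1_card natr_sum -sumrB.
    by apply: eq_bigr => z _; case: (F_fun f z x); rewrite /= ?expr1 ?expr0;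
      ring.
  have T1 : 1 <= T%:R :> R by rewrite ler1n.
  have del2 : n%:R * 2 ^+ h <= m / 2.
    have T32 : 2 <= 32 * T%:R ^+ 2 :> R by rewrite -natrX -natrM ler_nat; nia.
    apply: le_trans del_le _; rewrite ler_pM2l // lef_pV2 // posrE //.
    by apply: lt_le_trans T32.
  rewrite ler_norml; lra.
have [c cP|none] := pickP (fun c : 'I_(nout C) =>
  m / (4 * T%:R) <= agreement (H c) x).
  by exists c.
exfalso; move: sum_ge; apply/negP; rewrite -ltNge.
have T0 : 0 < T%:R :> R by rewrite ltr0n.
have [n0|n_gt0] := posnP (nout C).
  rewrite big1 ?divr_gt0 // => c _; by have := ltn_ord c; rewrite {2}n0.
apply: (@lt_le_trans _ _ (\sum_(c < nout C) m / (4 * T%:R))).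
  apply: ltr_sum => [|c _]; last by rewrite ltNge none.
  by apply/hasP; exists (Ordinal n_gt0) => //; exact: mem_index_enum.
have -> : m / 4 = T%:R * (m / (4 * T%:R)) by field; rewrite gt_eqF.
rewrite sumr_const card_ord -[leLHS]mulr_natl ler_wpM2r ?ler_nat //.
by apply: divr_ge0; [exact: ltW | rewrite mulr_ge0].
Qed.

(** The Johnson bound for correlation [m / (4T)]. *)
Lemma list_decoding H :
  (#|[set x | (x != zeros n) && (m / (4 * T%:R) <= agreement H x)%R]| <= 32 * T
    ^ 2)%N.
Proof.
set S := [set x | _].
have T0 : 0 < T%:R :> R by rewrite ltr0n.
have := @johnson_bound R _ _ S (fun x z => (-1) ^+ F_fun f z x) (fun z =>
  (-1) ^+ H z)
  (m / (4 * T%:R)) (m / (32 * T%:R ^+ 2)).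
rewrite card_z => J.
have {}J : #|S|%:R ^+ 2 * (m / (4 * T%:R)) ^+ 2 <=
    m * (#|S|%:R * m + #|S|%:R ^+ 2 * (m / (32 * T%:R ^+ 2))).
  apply: J => [x z|z|||x y _ _ xy|x].
  - exact: sqrr_sign.
  - exact: sqrr_sign.
  - by apply: divr_ge0; [exact: ltW | rewrite mulr_ge0].
  - by apply: divr_ge0; [exact: ltW | rewrite mulr_ge0 ?exprn_ge0].
  - apply: le_trans (ler_norm _) _.
    by apply: le_trans del_le; exact: F_fun_small_bias.
  - by rewrite inE => /andP[].
have [->//|S0] := posnP #|S|.
rewrite -(ler_nat R) natrM natrX.
have {}S0 : 0 < #|S|%:R :> R by rewrite ltr0n.
set L := #|S|%:R in J S0 *; set t := T%:R in J T0 *.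
(* Cancelling the common factor leaves [2 L <= 32 t^2 + L]. *)
have E1 : L ^+ 2 * (m / (4 * t)) ^+ 2 = (m ^+ 2 * L / (32 * t ^+ 2)) * (2 * L).
  by field; rewrite gt_eqF.
have E2 : m * (L * m + L ^+ 2 * (m / (32 * t ^+ 2))) =
    (m ^+ 2 * L / (32 * t ^+ 2)) * (32 * t ^+ 2 + L).
  by field; rewrite gt_eqF.
move: J; rewrite E1 E2 ler_pM2l; first by lra.
by rewrite divr_gt0 ?mulr_gt0 ?exprn_gt0.
Qed.

(** Each nonzero [x] lies in the list of some depth-2 function of [z]; the final 1 accounts for the
    zero vector. *)
Lemma code_counting :
  (forall x, exists r a, #|[pred b : 'I_(nbottom C) | bad (block_weight
    (bottom_gate b))
     (residual (bottom_gate b) x) r a]| <= l)%N ->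
  (2 ^ n <= 32 * T ^ 2 * (2 ^ k).+1 ^ ((k.+1 * l) + (k + l).+1) + 1)%N.
Proof.
move=> few.
pose S H := [set x | (x != zeros n) && (m / (4 * T%:R) <= agreement H x)%R].
have cover : [set~ zeros n] \subset \bigcup_(H in depth2 R k l) S H.
  apply/fintype.subsetP => x; rewrite in_setC1 => x0.
  have [r [a ra]] := few x; have [c cP] := discriminator r a x0.
  apply/bigcupP; exists [ffun z => out_value (input x (aim r a z)) c].
    exact: out_value_depth2.
  by rewrite inE x0.
have : (#|[set~ zeros n]| <= 32 * T ^ 2 * (2 ^ k).+1 ^ ((k.+1 * l) + (k +
  l).+1))%N.
  apply: leq_trans (subset_leq_card cover) _.
  apply: (@leq_trans (\sum_(H in depth2 R k l) #|S H|)%N).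
    apply: (big_ind2 (fun (A : {set n.-tuple bool}) m => #|A| <= m)%N) => //.
      by rewrite cards0.
    by move=> A i B j Ai Bj; rewrite cardsU (leq_trans (leq_subr _ _)) //
      leq_add.
  apply: (@leq_trans (\sum_(H in depth2 R k l) 32 * T ^ 2)%N).
    by apply: leq_sum => H _; exact: list_decoding.
  by rewrite sum_nat_const mulnC leq_mul2l card_depth2 orbT.
by rewrite cardsC1 card_tuple card_bool -subn1 leq_subLR addnC.
Qed.

End Counting.

(** * Averaging over the restrictions *)

Section Averaging.
Variables (R : rcfType) (K Q : finType).
Local Notation asg := {ffun K -> {ffun Q -> bool}}.
Local Notation q := (#|Q|%:R : R).
Local Notation restrictions := (#|{: {ffun K -> Q} * asg}|%:R : R).

Lemma restrictionsE : restrictions = q ^+ #|K| * #|asg|%:R.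
Proof. by rewrite card_prod natrM card_ffun natrX. Qed.

(** The square of the probability of being bad is at most [8 #|K| / #|Q|], and 3 exceeds the root of
    8. *)
Lemma bad_count_gate (b : K -> Q -> R) th : (2 * #|K| <= #|Q|)%N ->
  q * (\sum_r \sum_a (bad b th r a)%:R) <=
  3 * Num.sqrt (#|K| * #|Q|)%:R * restrictions.
Proof.
move=> kq; set S : R := \sum_r _.
have S0 : 0 <= S by apply: sumr_ge0 => r _; apply: sumr_ge0.
rewrite -ler_sqr ?nnegrE ?mulr_ge0 ?sqrtr_ge0 //.
rewrite !exprMn sqr_sqrtr // restrictionsE exprMn exprAC.
have supp_le : (\sum_i block_support b i)%:R <= (#|K| * #|Q|)%:R :> R.
  rewrite ler_nat -sum_nat_const; apply: leq_sum => i _; exact: max_card.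
have A0 : 0 <= 4 * #|asg|%:R ^+ 2 :> R by rewrite mulr_ge0 ?exprn_ge0.
have q0 : 0 <= q ^+ 2 by rewrite exprn_ge0.
apply: le_trans (ler_wpM2l q0 (bad_mass b th)) _.
rewrite [leLHS]mulrCA; apply: le_trans (ler_wpM2l A0 (coll_mass_gate b kq)) _.
set c := q ^+ 2 ^+ _; set A := #|asg|%:R ^+ 2.
have -> : 4 * A * (2 * c * (\sum_i block_support b i)%:R) = (8 * (\sum_i
  block_support b i)%:R) * (c * A) by ring.
apply: ler_wpM2r; first by rewrite mulr_ge0 // !exprn_ge0.
by apply: ler_pM => //; rewrite expr2; lra.
Qed.

(** Here both sides are squares up to the collision mass: a gate with [w] wires into the blocks is
    bad with probability at most [4 w / q^(3/2)]. *)
Lemma bad_count_wire (b : K -> Q -> R) th : (2 * #|K| <= #|Q|)%N ->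
  q * Num.sqrt q * (\sum_r \sum_a (bad b th r a)%:R) <=
  4 * (\sum_i block_support b i)%:R * restrictions.
Proof.
move=> kq; set S : R := \sum_r _.
have S0 : 0 <= S by apply: sumr_ge0 => r _; apply: sumr_ge0.
rewrite -ler_sqr ?nnegrE ?mulr_ge0 ?sqrtr_ge0 //.
rewrite !exprMn sqr_sqrtr // restrictionsE exprMn exprAC -exprSr.
have A0 : 0 <= 4 * #|asg|%:R ^+ 2 :> R by rewrite mulr_ge0 ?exprn_ge0.
have q0 : 0 <= q ^+ 3 by rewrite exprn_ge0.
apply: le_trans (ler_wpM2l q0 (bad_mass b th)) _.
rewrite [leLHS]mulrCA; apply: le_trans (ler_wpM2l A0 (coll_mass_wire b kq)) _.
by rewrite le_eqVlt; apply/orP; left; apply/eqP; ring.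
Qed.

Lemma exists_few_bad (B : finType) (P : B -> {ffun K -> Q} -> asg ->
  bool) (M : R) :
  (0 < #|Q|)%N ->
  \sum_b \sum_r \sum_a (P b r a)%:R <= M * restrictions ->
  exists r a, #|[pred b | P b r a]|%:R <= M.
Proof.
move=> Q0 avg.
have [[r a] /= ra|none] := pickP (fun p : {ffun K -> Q} * asg =>
  #|[pred b | P b p.1 p.2]|%:R <= M).
  by exists r, a.
exfalso; move: avg; apply/negP; rewrite -ltNge.
have -> : \sum_b \sum_r \sum_a (P b r a)%:R =
    \sum_(p : {ffun K -> Q} * asg) #|[pred b | P b p.1 p.2]|%:R :> R.
  rewrite -(pair_big xpredT xpredT (fun r a => #|[pred b | P b r a]|%:R)) /=.
  rewrite [LHS]exchange_big /=; apply: eq_bigr => r _.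
  rewrite [LHS]exchange_big /=; apply: eq_bigr => a _.
  by rewrite -sum1_card natr_sum [RHS]big_mkcond; apply: eq_bigr => b _;
    rewrite inE; case: (P _ _ _).
have -> : M * restrictions = \sum_(p : {ffun K -> Q} * asg) M.
  by rewrite sumr_const mulr_natr.
have /card_gt0P[t _] := Q0.
apply: ltr_sum => [|p _]; last by rewrite ltNge none.
by apply/hasP; exists ([ffun=> t], [ffun=> [ffun=> false]]) => //.
Qed.

End Averaging.

(** For [k = 16 L] the leading term is [2 k^2]; the linear one absorbs lower-order terms of the
    counting. The inequality fails at 17. *)
Lemma quadratic_le_exp2 (L : nat) : (18 <= L)%N ->
  (512 * L ^ 2 + 160 * L <= 2 ^ L)%N.
Proof.
elim: L => // L IH; rewrite leq_eqVlt => /orP[/eqP <- //|].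
rewrite ltnS => L18; have := IH L18; rewrite [(2 ^ L.+1)%N]expnS -!mulnn.
have : (18 * L <= L * L)%N by rewrite leq_mul2r L18 orbT.
move: (2 ^ L)%N => X; nia.
Qed.

Lemma fanin_block (R : realType) (k q : nat) (g : ltf R 'I_(k * q + k * q)) :
  (\sum_i block_support (block_weight g) i <= fanin g)%N.
Proof.
rewrite /fanin -sum1_card [leqRHS]big_mkcond big_split_ord /=.
rewrite [X in (_ <= _ + X)%N]big_idx; apply: leq_trans (leq_addl _ _).
apply: leq_sum => i _.
rewrite /block_support -sum1_card [leqLHS]big_mkcond; apply: leq_sum => t _.
by rewrite !inE.
Qed.

(** * Lower bounds for blocks of equal length *)

Section LowerBound.
Variables (R : realType) (f : nat -> {poly 'F_2}).
Hypothesis hf : GF2_moduli f.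
Variables (L q : nat).
Local Notation k := (8 * L + 8 * L)%N.
Local Notation n := (k * q)%N.
Hypothesis L_ge : (18 <= L)%N.
Hypothesis n_bounds : (2 ^ L <= n < 2 ^ L.+1)%N.

Lemma block_size : (2 * k <= q)%N.
Proof.
have : (512 * L ^ 2 <= n)%N.
  apply: leq_trans (leq_trans (leq_addr _ _) (quadratic_le_exp2 L_ge)) _.
  by case/andP: n_bounds.
by move: L_ge; nia.
Qed.

Variable C : maj_ltf_ltf R (n + n).
Hypothesis C_computes : computes C (B_fun f k).
Hypothesis nout_le : (nout C <= n ^ 3)%N.

(** If on average at most [n / (2 (k+2)^2)] gates were bad, some restriction for each [x] would
    leave so few that [code_counting] fails with [T = n ^ 3]. *)
Lemma surviving_gates (M : R) : 0 <= M ->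
  (forall th : 'I_(nbottom C) -> R, \sum_b \sum_r \sum_a
     (bad (block_weight (bottom_gate b)) (th b) r a)%:R <=
     M * #|{: {ffun 'I_k -> 'I_q} * {ffun 'I_k -> {ffun 'I_q -> bool}}}|%:R) ->
  n%:R < 2 * (k.+2 ^ 2)%:R * M.
Proof.
move=> M0 avg; rewrite ltNge; apply/negP => Mn.
have LD := quadratic_le_exp2 L_ge; have /andP[n_ge n_lt] := n_bounds.
have q0 : (0 < q)%N by have := block_size; move: L_ge; nia.
have h0 : (0 < 8 * L)%N by move: L_ge; nia.
have [f_irr f_size] := hf h0.
pose l := Num.truncn M.
have few x : exists r a, (#|[pred b : 'I_(nbottom C) | bad (block_weight
  (bottom_gate b))
     (residual (bottom_gate b) x) r a]| <= l)%N.
  have [|r [a ra]] := exists_few_bad _ (avg (fun b =>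
    residual (bottom_gate b) x)).
    by rewrite card_ord.
  by exists r, a; rewrite truncn_ge_nat.
have n0 : (0 < n)%N by apply: leq_trans n_ge; rewrite expn_gt0.
have T0 : (0 < n ^ 3)%N by rewrite expn_gt0 n0.
(* This is what [k = 16 L] is for: [2 ^ h = 2 ^ (8 L)] has to dominate [32 n ^ 7]. *)
have T_le : (32 * (n ^ 3) ^ 2 * n <= 2 ^ (8 * L))%N.
  rewrite -expnM -mulnA -expnSr.
  apply: (@leq_trans (2 ^ 5 * (2 ^ L.+1) ^ 7));
    first by rewrite leq_mul2l leq_exp2r // ltnW.
  by rewrite -expnM -expnD leq_exp2l //; move: L_ge; lia.
have := code_counting f_irr f_size C_computes T0 nout_le T_le few.
apply/negP; rewrite -ltnNge.
have kl : (2 * (k.+2 ^ 2 * l) <= n)%N.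
  rewrite -(ler_nat R); apply: le_trans Mn.
  by rewrite !natrM mulrA ler_wpM2l ?mulr_ge0 // truncn_le.
set e := (k.+1 * l + (k + l).+1)%N.
apply: (@leq_ltn_trans (2 ^ 5 * (2 ^ L.+1) ^ 6 * (2 ^ k.+1) ^ e + 1)%N).
  rewrite leq_add2r; apply: leq_mul.
    by rewrite leq_mul2l -expnM leq_exp2r // ltnW.
  have pw : ((2 ^ k).+1 <= 2 ^ k.+1)%N by rewrite expnS mul2n -addnn -addn1
    leq_add2l expn_gt0.
  by case: e => // e'; rewrite leq_exp2r.
rewrite -!expnM -!expnD.
(* It remains that [E < n]. Here [k.+1 * e] is at most [k.+2 ^ 2 * l + k.+1 ^ 2], whose first term
   is at most [n / 2]; the second one and [6 L + 12] together are at most [256 L^2 + 80 L], again at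
   most [n / 2]. *)
set E := (X in (2 ^ X)%N); apply: (@leq_trans (2 ^ E.+1)%N).
  by rewrite expnS mul2n -addnn -addnS leq_add2l -{1}(expn1 2) leq_exp2l // /E;
    lia.
rewrite leq_exp2l // /E /e.
have : (512 * L ^ 2 + 160 * L <= n)%N by apply: leq_trans LD n_ge.
move: kl L_ge; clear; set N := (n in (_ <= n)%N) => kl L18 H.
nia.
Qed.

(** With [q = n / k] this is of order [n^(3/2) / k^3]. *)
Lemma gates_bound :
  q%:R * n%:R < 6 * (k.+2 ^ 2)%:R * (nbottom C)%:R * Num.sqrt n%:R :> R.
Proof.
have kq := block_size.
have q0 : 0 < q%:R :> R by rewrite ltr0n; move: kq L_ge; nia.
pose M : R := (nbottom C)%:R * 3 * Num.sqrt n%:R / q%:R.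
have M0 : 0 <= M by rewrite divr_ge0 ?mulr_ge0 ?sqrtr_ge0.
have H := surviving_gates M0.
rewrite [ltLHS]mulrC -ltr_pdivlMr //.
have -> : 6 * (k.+2 ^ 2)%:R * (nbottom C)%:R * Num.sqrt n%:R / q%:R = 2 * (k.+2
  ^ 2)%:R * M.
  by rewrite /M; field; rewrite gt_eqF.
apply: H => th.
rewrite /M -(ler_pM2l q0) mulr_sumr.
set N := #|_|%:R.
have -> : q%:R * ((nbottom C)%:R * 3 * Num.sqrt n%:R / q%:R * N) =
    \sum_(b < nbottom C) 3 * Num.sqrt n%:R * N.
  by rewrite sumr_const card_ord -[RHS]mulr_natl; field; rewrite gt_eqF.
apply: ler_sum => b _.
have := @bad_count_gate R 'I_k 'I_q (block_weight (bottom_gate b)) (th b).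
by rewrite !card_ord; apply.
Qed.

(** Summing [bad_count_wire] over the bottom gates turns the supports into wires; with [q = n / k]
    the bound is of order [n^(5/2) / k^(7/2)]. *)
Lemma wires_bound :
  q%:R * Num.sqrt q%:R * n%:R < 8 * (k.+2 ^ 2)%:R * (wires C)%:R :> R.
Proof.
have kq := block_size.
have q0 : 0 < q%:R :> R by rewrite ltr0n; move: kq L_ge; nia.
have qq0 : 0 < q%:R * Num.sqrt q%:R :> R by rewrite mulr_gt0 ?sqrtr_gt0.
pose M : R := 4 * (wires C)%:R / (q%:R * Num.sqrt q%:R).
have M0 : 0 <= M by apply: divr_ge0; [rewrite mulr_ge0 | exact: ltW].
have H := surviving_gates M0.
rewrite [ltLHS]mulrC -ltr_pdivlMr //.
have -> : 8 * (k.+2 ^ 2)%:R * (wires C)%:R / (q%:R * Num.sqrt q%:R) = 2 * (k.+2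
  ^ 2)%:R * M.
  by rewrite /M; field; rewrite !gt_eqF ?sqrtr_gt0.
apply: H => th; rewrite /M -(ler_pM2l qq0) mulr_sumr.
set N := #|_|%:R.
have -> : q%:R * Num.sqrt q%:R * (4 * (wires C)%:R / (q%:R * Num.sqrt q%:R) *
  N) =
    4 * (wires C)%:R * N.
  by field; rewrite !gt_eqF ?sqrtr_gt0.
apply: (@le_trans _ _ (\sum_(b < nbottom C) 4 * (fanin (bottom_gate b))%:R *
  N)).
  apply: ler_sum => b _.
  have := @bad_count_wire R 'I_k 'I_q (block_weight (bottom_gate b)) (th b).
  rewrite !card_ord => /(_ kq) /le_trans; apply.
  by rewrite ler_wpM2r // ler_wpM2l // ler_nat fanin_block.
rewrite -mulr_suml -mulr_sumr -natr_sum ler_wpM2r // ler_wpM2l // ler_nat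
  /wires.
by rewrite -addnA leq_addr.
Qed.

End LowerBound.

(** * Asymptotics *)

Section Asymptotics.
Variables (R : realType) (f : nat -> {poly 'F_2}).
Hypothesis hf : GF2_moduli f.

Lemma ln2_ge_half : 2^-1 <= ln 2 :> R.
Proof.
have E : expR (- 2^-1) >= 2^-1 :> R by have := expR_ge1Dx (- 2^-1 : R); lra.
rewrite -[X in _ <= ln X]invrK lnV ?posrE ?invr_gt0 // lerNr.
by rewrite -ler_expR lnK ?posrE ?invr_gt0.
Qed.

Lemma le_ln_of_exp2 (L n : nat) : (2 ^ L <= n)%N -> L%:R <= 2 * ln n%:R :> R.
Proof.
move=> Ln; have n0 : (0 < n)%N by apply: leq_trans Ln; rewrite expn_gt0.
have : L%:R * ln 2 <= ln n%:R :> R.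
  by rewrite mulr_natl -lnXn // ler_ln ?posrE ?exprn_gt0 ?ltr0n // -natrX
    ler_nat.
by have := ler_wpM2l (ler0n R L) ln2_ge_half; lra.
Qed.

Lemma powR_half (a : R) (m : nat) : 0 < a ->
  a `^ ((2 * m + 1)%:R / 2) = a ^+ m * Num.sqrt a.
Proof.
move=> a0; have -> : (2 * m + 1)%:R / 2 = m%:R + 2^-1 :> R.
  by rewrite natrD natrM; field.
by rewrite powRD ?gt_eqF ?implybT // powR_mulrn ?ltW // powR12_sqrt // ltW.
Qed.

Section FixedLength.
Variable n : nat.
Hypothesis n_ge : (2 ^ 18 <= n)%N.
Hypothesis k_dvd : (kparam n %| n)%N.
Local Notation k := (kparam n).
Local Notation y := (ln n%:R : R).
Local Notation q := (n %/ k)%N.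

Let L_ge : (18 <= trunc_log 2 n)%N.
Proof. exact: trunc_log_max. Qed.

Let n_bounds : (2 ^ trunc_log 2 n <= n < 2 ^ (trunc_log 2 n).+1)%N.
Proof. by apply: trunc_log_bounds => //; apply: leq_trans n_ge. Qed.

Lemma kparam_le : k.+2%:R <= 34 * y.
Proof.
have := @le_ln_of_exp2 (trunc_log 2 n) n; case/andP: n_bounds => -> _ /(_ isT).
have : 18 <= (trunc_log 2 n)%:R :> R by rewrite ler_nat.
by rewrite -[k.+2]addn2 natrD [k%:R]natrM; lra.
Qed.

Lemma ln_ge1 : 1 <= y.
Proof.
have := @le_ln_of_exp2 (trunc_log 2 n) n; case/andP: n_bounds => -> _ /(_ isT).
have : 18 <= (trunc_log 2 n)%:R :> R by rewrite ler_nat.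
lra.
Qed.

Lemma n_ge1 : 1 <= n%:R :> R.
Proof. by rewrite ler1n; apply: leq_trans n_ge. Qed.

Variable C : maj_ltf_ltf R (n + n).
Hypothesis C_computes : computes C (B_fun f k).

(** A circuit within either size bound has at most [n^(5/2)] output gates, so [T = n ^ 3] is always
    admissible. *)
Lemma nout_cube (c : R) : 1 <= c ->
  (nout C)%:R <= n%:R ^+ 2 * Num.sqrt n%:R / c -> (nout C <= n ^ 3)%N.
Proof.
move=> c1 H; rewrite -(ler_nat R) natrX; apply: le_trans H _.
have n1 := n_ge1; have n0 : 0 <= n%:R :> R by [].
rewrite ler_pdivrMr ?(lt_le_trans ltr01) //.
have -> : n%:R ^+ 3 * c = n%:R ^+ 2 * (n%:R * c) by ring.
rewrite ler_wpM2l ?exprn_ge0 //.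
have sn : Num.sqrt n%:R <= n%:R :> R.
  by rewrite -ler_sqr ?nnegrE ?sqrtr_ge0 // sqr_sqrtr // expr2; nra.
by apply: le_trans sn _; rewrite ler_peMr.
Qed.

(** The type of the circuit depends on its length, so [n' = k' * q'] is stated for variables and
    eliminated by substitution. *)
Lemma size_bounds (L k' q' n' : nat) (C' : maj_ltf_ltf R (n' + n')) :
  (18 <= L)%N -> k' = (8 * L + 8 * L)%N -> n' = (k' * q')%N ->
  (2 ^ L <= n' < 2 ^ L.+1)%N -> computes C' (B_fun f k') ->
    (nout C' <= n' ^ 3)%N ->
  q'%:R * n'%:R < 6 * (k'.+2 ^ 2)%:R * (nbottom C')%:R * Num.sqrt n'%:R :> R /\
  q'%:R * Num.sqrt q'%:R * n'%:R < 8 * (k'.+2 ^ 2)%:R * (wires C')%:R :> R.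
Proof.
move=> L18 kE nE; subst k'; subst n' => nb CB T.
by split; [exact: (gates_bound hf L18 nb CB T) | exact: (wires_bound hf L18 nb
  CB T)].
Qed.

Let bounds (T : (nout C <= n ^ 3)%N) :=
  @size_bounds (trunc_log 2 n) k q n C L_ge
   ltac:(rewrite /kparam -mulnDl //) ltac:(by rewrite mulnC divnK) n_bounds
     C_computes T.

(** Multiplying [gates_bound] by [k] gives [n^2 < 6 (k+2)^3 G sqrt n], and [k + 2 <= 34 ln n]; hence
    the constant. *)
Lemma gates_gt (s : R) : (gates C)%:R <= s ->
  s <= (6 * 34 ^+ 3)^-1 * (n%:R `^ (3 / 2) / y ^+ 3) -> False.
Proof.
move=> Gs sn.
have n1 := n_ge1; have y1 := ln_ge1; have ky := kparam_le.
have n0 : 0 < n%:R :> R by apply: lt_le_trans n1.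
have y3 : 1 <= y ^+ 3 by rewrite exprn_ege1.
have y30 : 0 < y ^+ 3 by apply: lt_le_trans y3.
have sq0 : 0 < Num.sqrt n%:R :> R by rewrite sqrtr_gt0.
set G : R := (gates C)%:R in Gs.
set c : R := 6 * 34 ^+ 3 in sn.
have c1 : 1 <= c by rewrite mulr_ege1 ?exprn_ege1 // ler1n.
have c0 : 0 < c by apply: lt_le_trans c1.
have {Gs sn}GE : c * G * y ^+ 3 <= n%:R * Num.sqrt n%:R.
  have := le_trans Gs sn; have := powR_half 1 n0; rewrite muln1 expr1 => ->.
  by rewrite mulrA ler_pdivlMr // [_^-1 * _]mulrC ler_pdivlMr // mulrC mulrA.
have T : (nout C <= n ^ 3)%N.
  apply: (nout_cube y3); rewrite ler_pdivlMr //.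
  apply: (@le_trans _ _ (c * G * y ^+ 3)).
    rewrite ler_pM2r //; apply: (@le_trans _ _ G); last by rewrite ler_peMl.
    by rewrite ler_nat /gates addnAC leq_addl.
  apply: le_trans GE _; rewrite ler_pM2r // expr2 ler_peMl // ltW.
have [H _] := bounds T.
have nbG : (nbottom C)%:R <= G by rewrite ler_nat /gates -addnA leq_addr.
move: H; apply/negP; rewrite -leNgt.
have k0 : 0 < k%:R :> R by rewrite ltr0n muln_gt0 /=; apply: leq_trans L_ge.
have nE : n%:R = k%:R * q%:R :> R by rewrite -natrM mulnC divnK.
rewrite -(ler_pM2l k0) [leRHS]mulrA -nE.
have kk : k%:R <= k.+2%:R :> R by rewrite ler_nat -[k.+2]addn2 leq_addr.
apply: (@le_trans _ _ (k.+2%:R * (6 * (k.+2 ^ 2)%:R * G * Num.sqrt n%:R))).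
  apply: ler_pM => //.
  by rewrite ler_pM2r // ler_wpM2l // mulr_ge0.
rewrite natrX (_ : _ * _ = k.+2%:R ^+ 3 * (6 * G * Num.sqrt n%:R));
  last by ring.
apply: (@le_trans _ _ ((34 * y) ^+ 3 * (6 * G * Num.sqrt n%:R))).
  apply: ler_wpM2r; first by rewrite ?mulr_ge0 ?sqrtr_ge0.
  by rewrite lerXn2r // nnegrE // mulr_ge0 // (le_trans ler01).
rewrite (_ : _ * _ = c * G * y ^+ 3 * Num.sqrt n%:R); last by rewrite /c; ring.
apply: le_trans (ler_wpM2r (ltW sq0) GE) _.
by rewrite -mulrA -expr2 sqr_sqrtr.
Qed.

(** Multiplying [wires_bound] by [k sqrt k] turns its left side into [n^(5/2)]. The constant 48 is 8
    times the 6 from [sqrt k <= 6 sqrt (ln n)]. *)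
Lemma wires_gt (s : R) : (wires C)%:R <= s ->
  s <= (48 * 34 ^+ 3)^-1 * (n%:R `^ (5 / 2) / y `^ (7 / 2)) -> False.
Proof.
move=> Ws sn.
have n1 := n_ge1; have y1 := ln_ge1; have ky := kparam_le.
have n0 : 0 < n%:R :> R by apply: lt_le_trans n1.
have y0 : 0 < y by apply: lt_le_trans y1.
have sy0 : 0 < Num.sqrt y by rewrite sqrtr_gt0.
have sq0 : 0 < Num.sqrt n%:R :> R by rewrite sqrtr_gt0.
pose Y := y ^+ 3 * Num.sqrt y.
have Y1 : 1 <= Y.
  apply: mulr_ege1; first exact: exprn_ege1.
  by rewrite -[X in X <= _]sqrtr1 ler_wsqrtr.
have Y0 : 0 < Y by apply: lt_le_trans Y1.
set W : R := (wires C)%:R in Ws.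
set c : R := 48 * 34 ^+ 3 in sn.
have c1 : 1 <= c by rewrite mulr_ege1 ?exprn_ege1 // ler1n.
have c0 : 0 < c by apply: lt_le_trans c1.
have {Ws sn}WE : c * W * Y <= n%:R ^+ 2 * Num.sqrt n%:R.
  have := le_trans Ws sn; have := powR_half 2 n0; have := powR_half 3 y0.
  rewrite -/Y => -> ->.
  by rewrite mulrA ler_pdivlMr // [_^-1 * _]mulrC ler_pdivlMr // mulrC mulrA.
have T : (nout C <= n ^ 3)%N.
  apply: (nout_cube Y1); rewrite ler_pdivlMr //; apply: le_trans WE.
  rewrite ler_pM2r //; apply: (@le_trans _ _ W); last by rewrite ler_peMl.
  by rewrite ler_nat /wires leq_addl.
have [_ H] := bounds T.
move: H; apply/negP; rewrite -leNgt.
have k0 : 0 < k%:R :> R by rewrite ltr0n muln_gt0 /=; apply: leq_trans L_ge.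
have kk0 : 0 < k%:R * Num.sqrt k%:R :> R by rewrite mulr_gt0 ?sqrtr_gt0.
have nE : n%:R = k%:R * q%:R :> R by rewrite -natrM mulnC divnK.
rewrite -(ler_pM2l kk0) (_ : _ * (_ * n%:R) = n%:R ^+ 2 * Num.sqrt n%:R);
  last first.
  have -> : Num.sqrt n%:R = Num.sqrt k%:R * Num.sqrt q%:R :> R by rewrite nE
    sqrtrM.
  by rewrite expr2 {2}nE; ring.
apply: le_trans WE.
have kk : k%:R <= k.+2%:R :> R by rewrite ler_nat -[k.+2]addn2 leq_addr.
have sk : Num.sqrt k%:R <= 6 * Num.sqrt y.
  rewrite -ler_sqr ?nnegrE ?mulr_ge0 ?sqrtr_ge0 // exprMn !sqr_sqrtr // ?ltW
    //; lra.
apply: (@le_trans _ _ (k.+2%:R * (6 * Num.sqrt y) * (8 * (k.+2 ^ 2)%:R * W))).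
  apply: ler_wpM2r; first by rewrite !mulr_ge0.
  by apply: ler_pM => //; rewrite sqrtr_ge0.
rewrite natrX.
have -> : k.+2%:R * (6 * Num.sqrt y) * (8 * k.+2%:R ^+ 2 * W) =
    k.+2%:R ^+ 3 * (48 * W * Num.sqrt y) by ring.
apply: (@le_trans _ _ ((34 * y) ^+ 3 * (48 * W * Num.sqrt y))).
  apply: ler_wpM2r; first by rewrite ?mulr_ge0 ?sqrtr_ge0.
  by rewrite lerXn2r // nnegrE // mulr_ge0 // ltW.
by rewrite le_eqVlt; apply/orP; left; apply/eqP; rewrite /c /Y; ring.
Qed.

End FixedLength.
End Asymptotics.

Local Open Scope classical_set_scope.
Local Open Scope ring_scope.

Theorem theorem1p4 (R : realType) (f : nat -> {poly 'F_2})
    (hf : GF2_moduli f) :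
  (forall s : nat -> R,
     s =o_\oo (fun n : nat => n%:R `^ (3 / 2) / ln n%:R ^+ 3 : R) ->
     \forall n \near \oo, (kparam n %| n)%N ->
       ~ (exists C : maj_ltf_ltf R (n + n),
            computes C (B_fun f (kparam n)) /\ (gates C)%:R <= s n)) /\
  (forall s : nat -> R,
     s =o_\oo (fun n : nat => n%:R `^ (5 / 2) / ln n%:R `^ (7 / 2) : R) ->
     \forall n \near \oo, (kparam n %| n)%N ->
       ~ (exists C : maj_ltf_ltf R (n + n),
            computes C (B_fun f (kparam n)) /\ (wires C)%:R <= s n)).
Proof.
split=> s /eqoP small.
  (* The little-o hypothesis is applied at this single constant. *)
  have c0 : 0 < (6 * 34 ^+ 3)^-1 :> R by rewrite invr_gt0 mulr_gt0 ?exprn_gt0.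
  near=> n => k_dvd [C [CB Cs]].
  have n_ge : (2 ^ 18 <= n)%N by near: n; exact: nbhs_infty_ge.
  apply: (@gates_gt R f hf n n_ge k_dvd C CB (s n)) => //.
  apply: le_trans (ler_norm _) _.
  have y1 := ln_ge1 R n_ge.
  rewrite -[X in _ <= _ * X]ger0_norm; last by rewrite divr_ge0 ?powR_ge0 ?exprn_ge0 ?(le_trans ler01).
  by near: n; exact: small.
have c0 : 0 < (48 * 34 ^+ 3)^-1 :> R by rewrite invr_gt0 mulr_gt0 ?exprn_gt0.
near=> n => k_dvd [C [CB Cs]].
have n_ge : (2 ^ 18 <= n)%N by near: n; exact: nbhs_infty_ge.
apply: (@wires_gt R f hf n n_ge k_dvd C CB (s n)) => //.
apply: le_trans (ler_norm _) _.
rewrite -[X in _ <= _ * X]ger0_norm; last by rewrite divr_ge0 ?powR_ge0.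
by near: n; exact: small.
Unshelve. all: by end_near.
Qed.
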